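(* Fix an integer $s\ge 0$. For all integers $k\ge 0$ and $n\ge 1$ define $\sigma^{n,k,s}\in\mathbb{Q}V_{\mathrm{simple}}^{n,k,s}$ by the following recursion: (i) $\sigma^{1,0,s}$ is the graph consisting of a single vertex with $s$ external edges whose free ends are labeled $x_1,\dots,x_s$, with coefficient $1$ (and $\sigma^{1,k,s}=0$ for $k>0$, since $V_{\mathrm{simple}}^{1,k,s}=\emptyset$); (ii) for $n>1$, $$\sigma^{n,k,s}:=\frac{1}{k+n-1}\left(\sum_{i=1}^{n-1}q_i^{d(1)}(\sigma^{n-1,k,s})+\sum_{i=1}^{n}\sum_{j=1}^{i-1}l^b_{i,j}(\sigma^{n,k-1,s})\right),$$ where the $l^b_{i,j}$ summand does not appear when $k=0$ and/or $n=2$. Then, for all fixed $n$ and $k$, $\sigma^{n,k,s}=\sum_{G\in V_{\mathrm{simple}}^{n,k,s}}\alpha_G\,G$ with $\alpha_G\in\mathbb{Q}$ and $\alpha_G>0$ for all $G\in V_{\mathrm{simple}}^{n,k,s}$. Moreover, for every isomorphism class $\mathscr{C}\subseteq V_{\mathrm{simple}}^{n,k,s}$, $$\sum_{G\in\mathscr{C}}\alpha_G=\frac{1}{S^{\mathscr{C}}},$$ where $S^{\mathscr{C}}$ denotes the symmetry factor of the graphs in $\mathscr{C}$.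
   Context: Graphs. A graph consists of a finite nonempty set $V$ of vertices, a finite set $K$ of ends of edges, and a partition $E$ of $K$ into two-element subsets, called edges; $E=E_{\mathrm{int}}\sqcup E_{\mathrm{ext}}$. Each end of an internal edge (element of $E_{\mathrm{int}}$) is assigned to a vertex; for each external edge (element of $E_{\mathrm{ext}}$) one end is assigned to a vertex and the other end is free. If there are $s$ external edges, their free ends carry distinct labels $x_1,\dots,x_s$. An internal edge with both ends assigned to the same vertex is a loop. Two or more internal edges joining the same pair of distinct vertices are multiple edges. A graph is simple if it has no loops and no multiple edges. A graph is connected if any two distinct vertices are joined by a path of internal edges (a single vertex is connected). The cyclomatic number is $k=m-n+c$, where $m=|E_{\mathrm{int}}|$, $n=|V|$ and $c$ is the number of connected components. Isomorphisms. An isomorphism of graphs is a pair of bijections $\psi_V:V\to V^*$, $\psi_K:K\to K^*$ that maps internal edges to internal edges and external edges to external edges, respects the assignment of ends to vertices (and free ends), and preserves the labels of the external edges. The symmetry factor $S^G$ is the order of the group of automorphisms $(\psi_V,\psi_K)$ of $G$; it is constant on isomorphism classes. Sets of graphs. $V^{n,k,s}$ is the set of all graphs with vertex set $\{v_1,\dots,v_n\}$, cyclomatic number $k$, and $s$ external edges whose free ends are labeled $x_1,\dots,x_s$; the vertices are ordered (labeled), while graphs that differ only by renaming the ends of edges (i.e. that are isomorphic via some $(\psi_V,\psi_K)$ with $\psi_V=\mathrm{id}$) are identified. $V_{\mathrm{simple}}^{n,k,s}\subseteq V^{n,k,s}$ is the subset of simple connected graphs. An isomorphism class $\mathscr{C}\subseteq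 V_{\mathrm{simple}}^{n,k,s}$ is an equivalence class under isomorphism, where $\psi_V$ may permute $v_1,\dots,v_n$. For a set $W$, $\mathbb{Q}W$ is the free $\mathbb{Q}$-vector space on $W$. Linear maps, defined on graphs $G\in V^{n,k,s}$ and extended linearly: - $l_{i,j}(G)$, $i\ne j$, is $G$ with one additional internal edge joining $v_i$ and $v_j$. - $l^b_{i,j}(G)$, $i\ne j$, equals $l_{i,j}(G)$ if no internal edge of $G$ joins $v_i$ and $v_j$, and equals $0$ otherwise. - $s_i(G)$, $1\le i\le n$: let $\mathcal{E}_i$ be the set of all ends (of internal and external edges) assigned to $v_i$. Then $s_i(G)=\sum G_{(\mathcal{E}^{(1)},\mathcal{E}^{(2)})}$, the sum being over all ordered pairs of disjoint, possibly empty sets with $\mathcal{E}^{(1)}\cup\mathcal{E}^{(2)}=\mathcal{E}_i$, where $G_{(\mathcal{E}^{(1)},\mathcal{E}^{(2)})}$ is obtained from $G$ by adding a new vertex $v_{n+1}$, keeping the ends in $\mathcal{E}^{(1)}$ at $v_i$, and reassigning the ends in $\mathcal{E}^{(2)}$ to $v_{n+1}$. - $s_i^d(G)$ is the part of the sum $s_i(G)$ consisting of the disconnected graphs $G_{(\mathcal{E}^{(1)},\mathcal{E}^{(2)})}$. - $q_i^{d(1)}:=\frac12\, l_{i,n+1}\circ s_i^d$. *)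

(* Defs.v *)
From HB Require Import structures.
From mathcomp Require Import all_boot all_order all_fingroup all_algebra finmap.
From mathcomp.multinomials Require Import monalg.
(* fingroup also defines repr: the quotient one is meant below. *)
From mathcomp Require Import generic_quotient.

Set Implicit Arguments.
Unset Strict Implicit.
Unset Printing Implicit Defensive.

Import GRing.Theory.

Local Open Scope ring_scope.
Local Open Scope quotient_scope.

(* A concrete graph with vertices v_1, ..., v_n ('I_n, so v_i has index i-1)
   and s labelled external edges. Its set K of ends is ('I_m * bool) + ('I_s * bool):
   the a-th internal edge consists of the ends (a, false) and (a, true), and
   the external edge with label x_(j+1) consists of the end (j, false), which is
   assigned to a vertex, and of the free end (j, true), which carries the label.
   Loops and multiple edges are allowed. Every graph on these vertices is of
   this form up to a renaming of its ends. The data are the assignment of the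
   ends of the internal edges and of the non-free ends of the external edges. *)
Definition egraph (n s : nat) : Type :=
  {m : nat & ({ffun 'I_m * bool -> 'I_n} * {ffun 'I_s -> 'I_n})%type}.

Definition nint n s (G : egraph n s) : nat := tag G.

Definition iatt n s (G : egraph n s) : {ffun 'I_(nint G) * bool -> 'I_n} :=
  (tagged G).1.

Definition xatt n s (G : egraph n s) : {ffun 'I_s -> 'I_n} := (tagged G).2.

Definition ends n s (G : egraph n s) : finType :=
  (('I_(nint G) * bool) + ('I_s * bool))%type.

(* The assignment of ends to vertices; None for the free ends. *)
Definition att n s (G : egraph n s) (x : ends G) : option 'I_n :=
  match x with
  | inl d => Some (iatt G d)
  | inr (j, false) => Some (xatt G j)
  | inr (j, true) => None
  end.

Definition free_end n s (G : egraph n s) (j : 'I_s) : ends G := inr (j, true).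

Definition iedges n s (G : egraph n s) : {set {set ends G}} :=
  [set [set inl (a, false); inl (a, true)] | a : 'I_(nint G)].

Definition xedges n s (G : egraph n s) : {set {set ends G}} :=
  [set [set inr (j, false); inr (j, true)] | j : 'I_s].

Definition is_iso n s (G H : egraph n s)
    (psiV : {perm 'I_n}) (psiK : {ffun ends G -> ends H}) : bool :=
  [&& injectiveb psiK, [forall y, exists x, psiK x == y],
      [forall e in iedges G, psiK @: e \in iedges H],
      [forall e in xedges G, psiK @: e \in xedges H],
      [forall x, att (psiK x) == omap psiV (att x)] &
      [forall j, psiK (free_end G j) == free_end H j]].

Definition iso n s (G H : egraph n s) : bool :=
  [exists psiV : {perm 'I_n}, exists psiK, is_iso (G := G) (H := H) psiV psiK].

(* Isomorphic with psiV = id: the graphs differ by a renaming of the ends. *)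
Definition iso_id n s (G H : egraph n s) : bool :=
  [exists psiK, is_iso (G := G) (H := H) 1%g psiK].

Definition symfactor n s (G : egraph n s) : nat :=
  #|[set psi : {perm 'I_n} * {ffun ends G -> ends G} | is_iso psi.1 psi.2]|.

Definition joins n s (G : egraph n s) (a : 'I_(nint G)) (v w : 'I_n) : bool :=
  [exists b : bool, (iatt G (a, b) == v) && (iatt G (a, ~~ b) == w)].

Definition adj n s (G : egraph n s) : rel 'I_n :=
  fun v w => [exists a, joins (G := G) a v w].

Definition has_loop n s (G : egraph n s) : bool :=
  [exists a, iatt G (a, false) == iatt G (a, true)].

Definition has_multiple_edges n s (G : egraph n s) : bool :=
  [exists v : 'I_n, exists w : 'I_n, exists a, exists b,
    [&& v != w, a != b, joins (G := G) a v w & joins (G := G) b v w]].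

Definition simple_graph n s (G : egraph n s) : bool :=
  ~~ has_loop G && ~~ has_multiple_edges G.

Definition connected_graph n s (G : egraph n s) : bool :=
  [forall v : 'I_n, forall w : 'I_n, connect (adj G) v w].

Definition cyclomatic n s (G : egraph n s) : int :=
  (nint G)%:Z - n%:Z + (n_comp (adj G) 'I_n)%:Z.

Definition add_edge n s (G : egraph n s) (i j : 'I_n) : egraph n s :=
  existT _ (nint G).+1
    ([ffun d : 'I_(nint G).+1 * bool =>
        if unlift ord_max d.1 is Some a then iatt G (a, d.2)
        else if d.2 then j else i],
     xatt G).

Definition old_vertex n (v : 'I_n) : 'I_n.+1 := widen_ord (leqnSn n) v.
Definition new_vertex n : 'I_n.+1 := ord_max.

(* The ends in E2 are reassigned to the new vertex; all other ends stay. *)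
Definition split_vertex n s (G : egraph n s) (E2 : {set ends G}) : egraph n.+1 s :=
  let move (x : ends G) v := if x \in E2 then new_vertex n else old_vertex v in
  existT _ (nint G)
    ([ffun d : 'I_(nint G) * bool => move (inl d) (iatt G d)],
     [ffun j : 'I_s => move (inr (j, false)) (xatt G j)]).

Definition ends_at n s (G : egraph n s) (i : 'I_n) : {set ends G} :=
  [set x | att x == Some i].

Lemma is_isoP n s (G H : egraph n s) (p : {perm 'I_n}) (f : {ffun ends G -> ends H}) :
  reflect [/\ bijective f,
              forall e, e \in iedges G -> f @: e \in iedges H,
              forall e, e \in xedges G -> f @: e \in xedges H,
              forall x, att (f x) = omap p (att x) &
              forall j, f (free_end G j) = free_end H j]
          (is_iso p f).
Proof.
apply: (iffP and5P) => [[/injectiveP fI /forallP fS /forall_inP Hi /forall_inP Hx]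
                        /andP[/forallP Ha /forallP Hf]|[fB Hi Hx Ha Hf]].
  split=> // [|x|j]; try exact/eqP.
  pose g y := xchoose (existsP (fS y)).
  have gK y : f (g y) = y by apply/eqP; exact: xchooseP (existsP (fS y)).
  by exists g => // x; apply: fI.
split; last (apply/andP; split).
- exact/injectiveP/bij_inj.
- by case: fB => g _ gK; apply/forallP => y; apply/existsP; exists (g y); rewrite gK.
- exact/forall_inP.
- exact/forall_inP.
- by apply/forallP => x; rewrite Ha.
- by apply/forallP => j; rewrite Hf.
Qed.

Lemma is_iso_id n s (G : egraph n s) : is_iso 1%g [ffun x : ends G => x].
Proof.
have E (e : {set ends G}) : [ffun x : ends G => x] @: e = e.
  by rewrite -[RHS]imset_id; apply: eq_imset => x; rewrite ffunE.
apply/is_isoP; split=> [|e|e|x|j]; rewrite ?E ?ffunE //.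
  by exists id => x; rewrite ffunE.
by case: (att x) => //= v; rewrite perm1.
Qed.

Lemma is_iso_comp n s (G H I : egraph n s) (p q : {perm 'I_n})
    (f : {ffun ends G -> ends H}) (g : {ffun ends H -> ends I}) :
  is_iso p f -> is_iso q g -> is_iso (p * q)%g [ffun x => g (f x)].
Proof.
move=> /is_isoP[fB fi fx fa ff] /is_isoP[gB gi gx ga gf].
have E (e : {set ends G}) : [ffun x => g (f x)] @: e = g @: (f @: e).
  by rewrite -imset_comp; apply: eq_imset => x; rewrite ffunE.
apply/is_isoP; split=> [|e /fi/gi|e /fx/gx|x|j]; rewrite ?E ?ffunE ?ff //.
  by apply: (eq_bij (bij_comp gB fB)) => x; rewrite ffunE.
by rewrite ga fa; case: (att x) => //= v; rewrite permM.
Qed.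

Lemma card_iedges n s (G : egraph n s) : #|iedges G| = nint G.
Proof.
rewrite card_imset ?card_ord // => a b /setP/(_ (inl (a, false))).
by rewrite !inE eqxx /= => /esym/orP[] /eqP[].
Qed.

Lemma card_xedges n s (G : egraph n s) : #|xedges G| = s.
Proof.
rewrite card_imset ?card_ord // => a b /setP/(_ (inr (a, false))).
by rewrite !inE eqxx /= => /esym/orP[] /eqP[].
Qed.

Lemma is_iso_inv n s (G H : egraph n s) (p : {perm 'I_n})
    (f : {ffun ends G -> ends H}) :
  is_iso p f -> exists g : {ffun ends H -> ends G}, is_iso p^-1%g g.
Proof.
move=> /is_isoP[fB fi fx fa ff]; have [g fK gK] := fB; exists [ffun y => g y].
have fI : injective f by apply: bij_inj.
have eG : nint G = nint H.
  have /eqP := bij_eq_card fB.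
  by rewrite !card_sum !card_prod !card_ord card_bool eqn_add2r eqn_pmul2r // => /eqP.
have Ei : [set f @: e | e : {set ends G} in iedges G] = iedges H.
  apply/eqP; rewrite eqEcard; apply/andP; split.
    by apply/subsetP => _ /imsetP[e /fi ? ->].
  by rewrite !card_iedges -eG (card_imset _ (imset_inj fI)) card_iedges.
have Ex : [set f @: e | e : {set ends G} in xedges G] = xedges H.
  apply/eqP; rewrite eqEcard; apply/andP; split.
    by apply/subsetP => _ /imsetP[e /fx ? ->].
  by rewrite !card_xedges (card_imset _ (imset_inj fI)) card_xedges.
have E (e : {set ends G}) : [ffun y => g y] @: (f @: e) = e.
  rewrite -imset_comp -[RHS]imset_id; apply: eq_imset => x.
  by rewrite /= ffunE fK.
apply/is_isoP; split=> [|e|e|x|j].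
- by exists f => x; rewrite ffunE.
- by rewrite -Ei => /imsetP[e' e'G ->]; rewrite E.
- by rewrite -Ex => /imsetP[e' e'G ->]; rewrite E.
- rewrite ffunE -{2}[x]gK fa; case: (att _) => //= v; by rewrite permK.
- by rewrite ffunE -ff fK.
Qed.

Lemma iso_id_refl n s : reflexive (@iso_id n s).
Proof. by move=> G; apply/existsP; exists [ffun x => x]; exact: is_iso_id. Qed.

Lemma iso_id_sym n s : symmetric (@iso_id n s).
Proof.
by move=> G H; apply/idP/idP => /existsP[f /is_iso_inv[g]];
  rewrite invg1 => gP; apply/existsP; exists g.
Qed.

Lemma iso_id_trans n s : transitive (@iso_id n s).
Proof.
move=> H G I /existsP[f fP] /existsP[g gP]; apply/existsP.
by exists [ffun x => g (f x)]; rewrite -(mulg1 1%g); exact: is_iso_comp fP gP.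
Qed.

Canonical iso_id_equiv n s :=
  EquivRel (@iso_id n s) (@iso_id_refl n s) (@iso_id_sym n s) (@iso_id_trans n s).

(* The union over k of the sets V^{n,k,s}: graphs up to renaming of ends.
   All notions below are read off a representative; they do not depend on its
   choice. *)
Definition mgraph (n s : nat) : Type := {eq_quot (@iso_id n s)}.

HB.instance Definition _ n s := Choice.on (mgraph n s).
HB.instance Definition _ n s := EqQuotient.on (mgraph n s).

Definition Vsimple (n k s : nat) (G : mgraph n s) : bool :=
  [&& simple_graph (repr G), connected_graph (repr G) & cyclomatic (repr G) == k%:Z].

Definition isomorphic n s (G H : mgraph n s) : bool := iso (repr G) (repr H).

Definition is_iso_class n s (C : {fset mgraph n s}) : Prop :=
  exists G0, forall G, (G \in C) = isomorphic G0 G.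

Definition symmetry_factor n s (G : mgraph n s) : nat := symfactor (repr G).

(* The free Q-vector space on mgraph n s; << G >> is the basis element G. *)
Definition QV (n s : nat) : Type := {malg rat[mgraph n s]}.

Definition linext n n' s (f : mgraph n s -> QV n' s) (x : QV n s) : QV n' s :=
  \sum_(G <- msupp x) x@_G *: f G.

Definition l_graph n s (i j : 'I_n) (G : mgraph n s) : QV n s :=
  << \pi_(mgraph n s) (add_edge (repr G) i j) >>.

Definition lb_graph n s (i j : 'I_n) (G : mgraph n s) : QV n s :=
  if adj (repr G) i j then 0 else l_graph i j G.

(* The disconnected part of the sum over the ordered pairs (E.1, E.2). *)
Definition sd_graph n s (i : 'I_n) (G : mgraph n s) : QV n.+1 s :=
  \sum_(E : {set ends (repr G)} * {set ends (repr G)} |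
          [&& E.1 :&: E.2 == set0, E.1 :|: E.2 == ends_at (repr G) i &
              ~~ connected_graph (split_vertex E.2)])
     << \pi_(mgraph n.+1 s) (split_vertex E.2) >>.

Definition l_map n s (i j : 'I_n) : QV n s -> QV n s := linext (l_graph i j).
Definition lb_map n s (i j : 'I_n) : QV n s -> QV n s := linext (lb_graph i j).
Definition sd_map n s (i : 'I_n) : QV n s -> QV n.+1 s := linext (sd_graph i).

Definition qd1 n s (i : 'I_n) (x : QV n s) : QV n.+1 s :=
  2^-1 *: l_map (old_vertex i) (new_vertex n) (sd_map i x).

Definition one_vertex_graph s : mgraph 1 s :=
  \pi_(mgraph 1 s)
    (existT _ 0%N ([ffun=> ord0], [ffun=> ord0]) : egraph 1 s).

(* sigma^{n+1,k,s} from the family sigma^{n,_,s}. *)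
Definition sigma_step s n : (nat -> QV n s) -> nat -> QV n.+1 s :=
  match n return (nat -> QV n s) -> nat -> QV n.+1 s with
  | 0 => fun _ k => if k == 0%N then << one_vertex_graph s >> else 0
  | p.+1 => fun prev =>
      fix sig k :=
        ((k + p.+2 - 1)%N%:R)^-1 *:
          (\sum_(i < p.+1) qd1 i (prev k) +
           (if k is k'.+1 then
              if p.+2 == 2%N then 0
              else \sum_(i < p.+2) \sum_(j < p.+2 | (j < i)%N) lb_map i j (sig k')
            else 0))
  end.

(* sigma s n k is sigma^{n,k,s}; the value at n = 0 is junk. *)
Fixpoint sigma s n : nat -> QV n s :=
  match n with
  | 0 => fun _ => 0
  | n'.+1 => sigma_step (sigma s n')
  end.

Lemma sigma1E s k :
  sigma s 1 k = if k == 0%N then << one_vertex_graph s >> else 0.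
Proof. by []. Qed.

Lemma sigmaE s p k (n := p.+2) :
  sigma s n k =
  ((k + n - 1)%N%:R)^-1 *:
    (\sum_(i < n.-1) qd1 i (sigma s n.-1 k) +
     (if (k == 0%N) || (n == 2%N) then 0
      else \sum_(i < n) \sum_(j < n | (j < i)%N) lb_map i j (sigma s n k.-1))).
Proof. by case: k => [|k] //=; rewrite /n; case: p. Qed.

(* Main.v *)
Require Import Defs.
From HB Require Import structures.
From mathcomp Require Import all_boot all_order all_fingroup all_algebra finmap.
From mathcomp.multinomials Require Import monalg.
From mathcomp Require Import generic_quotient zify ring.

(** Call a function f on labelled graphs invariant if it does not change when the
    vertices are permuted. All of the theorem but positivity follows from one formula
    (evaluate_invariant): the linear extension of an invariant f takes at sigma^{n,k,s}
    the value 1/n! times the sum of f over all simple connected labelled graphs. Thus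
    invariant functions cannot tell sigma^{n,k,s} from the combination that gives every
    graph the weight 1/n!. For f the indicator of an isomorphism class the value is
    1/n! times the size of the class, and this is the inverse of the symmetry factor
    because a class is an orbit of the symmetric group whose stabiliser is the group of
    automorphisms (card_orbit_symfactor).

    The formula is proved by induction along the recursion. Splitting v_i into two
    components and joining them again by an edge is inverse to contracting a bridge
    between v_i and the last vertex (sum_split). By the induction hypothesis the first
    sum of the recursion therefore contributes 1/2 times 1/(n-1)! times the sum, over
    the graphs N on n vertices, of f(N) times the number of bridges at v_n. By
    invariance v_n may be replaced with an average over all n vertices, and each bridge
    then counts at both its ends: the contribution is 1/n! times the sum of f(N) times
    the number of bridges of N (sum_bridged). In the same way, inserting an edge into a
    connected graph is inverse to deleting an edge that is not a bridge, so the second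
    sum contributes 1/n! times the sum of f(N) times the number of other edges
    (sum_link). Together every edge of N is counted once, that is k + n - 1 times, which
    the prefactor 1/(k+n-1) cancels. Leaving out the second sum for k = 0 or n = 2 does
    no harm, since then every edge is a bridge or there is no graph at all
    (nonbridge_tree, valid_two).

    Positivity (evaluate_delta_gt0) is independent of this: nothing cancels in the
    recursion, and every N arises in it, by contracting an edge at the last vertex if
    that is a bridge and by deleting it otherwise.

    The combinatorics takes place on labelled graphs encoded by their directed edges
    (darts). A simple graph with ends is determined by its darts up to a unique renaming
    of the ends (iso_of_skel, iso_unique), so no information on classes or
    automorphisms is lost. *)

Set Implicit Arguments.
Unset Strict Implicit.
Unset Printing Implicit Defensive.

Import Order.TTheory GRing.Theory Num.Theory.

(** * Labelled simple graphs as sets of darts *)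

Definition dmap (T U : Type) (h : T -> U) (z : T * T) : U * U := (h z.1, h z.2).

Notation lgraph n s := ({set 'I_n * 'I_n} * {ffun 'I_s -> 'I_n})%type.

Section Darts.

Variable n : nat.
Implicit Types (A B : {set 'I_n * 'I_n}) (u v w : 'I_n).

Definition reach A : rel 'I_n := connect (fun v w => (v, w) \in A).

Definition conn A : bool := [forall v, forall w, reach A v w].

(** An edge is present as both of its darts, so that #|A| is twice the number of edges. *)
Definition simple_darts A : bool :=
  [forall v, forall w, ((v, w) \in A) ==> (v != w) && ((w, v) \in A)].

Definition edge_darts v w : {set 'I_n * 'I_n} := [set (v, w); (w, v)].

Definition cut A v w := A :\: edge_darts v w.

Definition link A v w := edge_darts v w :|: A.

Definition bridge A v w := ((v, w) \in A) && ~~ conn (cut A v w).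

Definition nonbridge A v w := ((v, w) \in A) && conn (cut A v w).

Lemma connP A : reflect (forall v w, reach A v w) (conn A).
Proof. exact: 'forall_forallP. Qed.

Lemma simple_dartsP A :
  reflect ((forall v, (v, v) \notin A) /\
           (forall v w, (v, w) \in A -> (w, v) \in A)) (simple_darts A).
Proof.
apply: (iffP 'forall_'forall_implyP) => [H|[irrA symA] v w vwA].
  split=> [v|v w vwA]; last by case/andP: (H v w vwA).
  by apply/negP => vvA; case/andP: (H v v vvA); rewrite eqxx.
by rewrite symA // andbT; apply: contraTneq vwA => ->.
Qed.

Lemma simple_darts_irr A v w : simple_darts A -> (v, w) \in A -> v != w.
Proof. by case/simple_dartsP=> irrA _ vwA; apply: contraTneq vwA => ->. Qed.

Lemma simple_darts_sym A v w : simple_darts A -> ((v, w) \in A) = ((w, v) \in A).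
Proof. by case/simple_dartsP=> _ symA; apply/idP/idP; apply: symA. Qed.

Lemma reach_refl A v : reach A v v.
Proof. exact: connect0. Qed.

Lemma reach1 A v w : (v, w) \in A -> reach A v w.
Proof. by move=> vwA; apply: connect1. Qed.

Lemma reach_trans A v u w : reach A v u -> reach A u w -> reach A v w.
Proof. exact: connect_trans. Qed.

Lemma edge_dartsC v w : edge_darts v w = edge_darts w v.
Proof. exact: setUC. Qed.

Lemma cutC A v w : cut A v w = cut A w v.
Proof. by rewrite /cut edge_dartsC. Qed.

Lemma linkC A v w : link A v w = link A w v.
Proof. by rewrite /link edge_dartsC. Qed.

Lemma cut_link A v w : simple_darts A -> (v, w) \notin A -> cut (link A v w) v w = A.
Proof.
move=> sA vwA; apply/setP=> z; rewrite !inE.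
have [->|_] := eqVneq z (v, w); first by rewrite (negPf vwA).
have [->|_] := eqVneq z (w, v) => //=.
by rewrite (simple_darts_sym _ _ sA) (negPf vwA).
Qed.

Lemma link_cut A v w : simple_darts A -> (v, w) \in A -> link (cut A v w) v w = A.
Proof.
move=> sA vwA; apply/setP=> z; rewrite !inE.
have [->|_] := eqVneq z (v, w); first by rewrite vwA.
have [->|_] := eqVneq z (w, v) => //=.
by rewrite (simple_darts_sym _ _ sA) vwA.
Qed.

Lemma simple_darts_cut A v w : simple_darts A -> simple_darts (cut A v w).
Proof.
move=> /simple_dartsP[irrA symA]; apply/simple_dartsP; split=> [u|x y].
  by rewrite !inE (negPf (irrA u)) andbF.
rewrite !inE !xpair_eqE => /andP[+ /symA ->]; rewrite andbT.
by apply: contraNN => /orP[]/andP[-> ->]; rewrite ?orbT.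
Qed.

Lemma simple_darts_link A v w : v != w -> simple_darts A -> simple_darts (link A v w).
Proof.
move=> vw /simple_dartsP[irrA symA]; apply/simple_dartsP; split=> [u|x y].
  rewrite !inE (negPf (irrA u)) orbF !xpair_eqE negb_or !negb_and.
  by have [->|] := eqVneq u v; rewrite ?vw //; move=> _; rewrite orbT.
rewrite !inE !xpair_eqE => /orP[|/symA ->]; last by rewrite orbT.
by case/orP=> /andP[-> ->]; rewrite ?orbT.
Qed.

Lemma card_edge_darts v w : v != w -> #|edge_darts v w| = 2.
Proof. by move=> vw; rewrite cards2 xpair_eqE (negPf vw). Qed.

Lemma card_cut A v w : simple_darts A -> (v, w) \in A -> #|A| = #|cut A v w|.+2.
Proof.
move=> sA vwA; rewrite -(cardsID (edge_darts v w) A).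
rewrite (setIidPr _) ?card_edge_darts //; first exact: simple_darts_irr vwA.
apply/subsetP=> z; rewrite !inE.
by case/orP=> /eqP-> //; rewrite (simple_darts_sym _ _ sA).
Qed.

Lemma card_link A v w : simple_darts A -> v != w -> (v, w) \notin A ->
  #|link A v w| = #|A|.+2.
Proof.
move=> sA vw vwA; rewrite (@card_cut _ v w) ?cut_link ?simple_darts_link //.
by rewrite !inE eqxx.
Qed.

Lemma bridgeC A v w : simple_darts A -> bridge A v w = bridge A w v.
Proof. by move=> sA; rewrite /bridge cutC (simple_darts_sym _ _ sA). Qed.

Lemma bridge_irr A v : simple_darts A -> bridge A v v = false.
Proof. by case/simple_dartsP=> irrA _; rewrite /bridge (negPf (irrA v)). Qed.

(** Bridges and non-bridges together exhaust the edges, each edge being met once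
    in either direction. *)
Lemma sum_bridges A :
  \sum_v \sum_w (bridge A v w + nonbridge A v w) = #|A|.
Proof.
rewrite pair_big -sum1_card [RHS]big_mkcond; apply: eq_bigr => -[v w] _ /=.
by rewrite /bridge /nonbridge; case: (_ \in A); case: conn.
Qed.

(** The darts miss the diagonal. *)
Lemma simple_darts_card A : simple_darts A -> #|A| + n <= n * n.
Proof.
case/simple_dartsP=> irrA _; pose D := [set (v, v) | v : 'I_n].
have cD : #|D| = n by rewrite card_imset ?card_ord // => v w [].
have dj : A :&: D = set0.
  apply/setP=> z; rewrite !inE; apply/negP => /andP[zA /imsetP[v _ zv]].
  by rewrite zv (negPf (irrA v)) in zA.
have := max_card (A :|: D).
by rewrite cardsU dj cards0 subn0 cD card_prod card_ord.
Qed.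

End Darts.

Arguments simple_darts_irr {n A v w}.
Arguments simple_darts_sym {n A}.

(** Enlarge a set of vertices one at a time, starting from a single vertex: as
    long as it is not everything, connectedness provides an edge that leaves it,
    and the two directions of this edge are new. *)
Lemma conn_card n (A : {set 'I_n * 'I_n}) : simple_darts A -> conn A -> n.-1.*2 <= #|A|.
Proof.
case: n A => [|m] A sA cA //=.
suff grow j : j <= m -> exists S : {set 'I_m.+1},
    [/\ ord0 \in S, #|S| = j.+1 & j.*2 <= #|[set z in A | (z.1 \in S) && (z.2 \in S)]|].
  have [S [_ _ leS]] := grow m (leqnn m); apply: leq_trans leS _.
  by apply: subset_leq_card; apply/subsetP=> z; rewrite inE => /andP[].
elim: j => [_|j IHj ltjm]; first by exists [set ord0]; rewrite set11 cards1.
have [S [S0 cS leS]] := IHj (ltnW ltjm).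
have [[u w] /and3P[/= uwA uS wS]] :
    exists z, [&& z \in A, z.1 \in S & z.2 \notin S].
  apply/existsP; rewrite -[[exists _, _]]negbK negb_exists; apply/negP => /forallP noexit.
  have clS : closed (fun v w => (v, w) \in A) S.
    move=> v w vwA; apply/idP/idP => Sv.
      by move: (noexit (v, w)); rewrite /= vwA Sv => /negPn.
    move: (noexit (w, v)); rewrite /= Sv negb_and negbK => /orP[/negP[]|/=]; last by [].
    by rewrite (simple_darts_sym _ _ sA) vwA.
  have S1 v : v \in S.
    by have /connP/(_ ord0 v) := cA; move=> /(closed_connect clS) <-.
  have : #|S| = m.+1 by rewrite -[RHS]card_ord; apply: eq_card.
  by rewrite cS => -[jm]; rewrite jm ltnn in ltjm.
exists (w |: S); rewrite inE S0 orbT cardsU1 wS cS; split=> //.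
have uw := simple_darts_irr sA uwA.
rewrite doubleS -add2n -(card_edge_darts uw).
set T := [set z in A | _] in leS; set T' := [set z in A | _].
have sub : edge_darts u w :|: T \subset T'.
  apply/subsetP=> z; rewrite !inE -orbA => /or3P[/eqP->|/eqP->|/and3P[-> -> ->]] /=.
  - by rewrite uwA uS eqxx orbT.
  - by rewrite (simple_darts_sym _ _ sA) uwA uS eqxx orbT.
  - by rewrite !orbT.
apply: leq_trans (subset_leq_card sub).
have dj : edge_darts u w :&: T = set0.
  apply/setP=> z; rewrite !inE; apply/negP.
  by case/andP=> /orP[]/eqP-> /and3P[_ /=]; rewrite (negPf wS).
by rewrite cardsU dj cards0 subn0 leq_add2l.
Qed.

(** It suffices that h sends steps to walks, not to steps: contraction sends the
    contracted edge to a point, and a deleted edge may be replaced with a detour. *)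
Lemma reach_homo n m (A : {set 'I_n * 'I_n}) (B : {set 'I_m * 'I_m}) (h : 'I_n -> 'I_m) :
  (forall v w, (v, w) \in A -> reach B (h v) (h w)) ->
  forall v w, reach A v w -> reach B (h v) (h w).
Proof.
move=> hAB v w /connectP[p]; elim: p v => [|u p IHp] v /= => [_ ->|].
  exact: reach_refl.
by case/andP=> /hAB vu /IHp uw /uw; apply: reach_trans.
Qed.

Lemma conn_sub n (A B : {set 'I_n * 'I_n}) :
  (forall v w, (v, w) \in A -> reach B v w) -> conn A -> conn B.
Proof.
by move=> AB /connP cA; apply/connP=> v w; apply: (@reach_homo _ _ A B id).
Qed.

Lemma conn_link n (A : {set 'I_n * 'I_n}) v w : conn A -> conn (link A v w).
Proof.
by apply: conn_sub => x y xyA; apply: reach1; rewrite inE xyA orbT.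
Qed.

(** A common neighbour would provide a detour around the bridge. Hence contracting
    a bridge never makes two edges coincide. *)
Lemma bridge_common n (A : {set 'I_n * 'I_n}) v w u :
  simple_darts A -> conn A -> bridge A v w ->
  (v, u) \in A -> (w, u) \in A -> False.
Proof.
move=> sA cA /andP[vwA nc] vuA wuA; case/negP: nc; apply: conn_sub cA => x y xyA.
have [vw vu wu] := And3 (simple_darts_irr sA vwA) (simple_darts_irr sA vuA)
  (simple_darts_irr sA wuA).
have sC := simple_darts_cut v w sA.
have vuC : (v, u) \in cut A v w.
  by rewrite !inE vuA !xpair_eqE eqxx (negPf vw) /= eq_sym (negPf wu).
have wuC : (w, u) \in cut A v w.
  by rewrite !inE wuA !xpair_eqE eqxx [w == v]eq_sym (negPf vw) /= eq_sym (negPf vu).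
have [xyE|xyE] := boolP ((x, y) \in edge_darts v w); last first.
  by apply: reach1; rewrite inE xyE.
move: xyE; rewrite !inE => /orP[]/eqP[-> ->].
  by apply: (@reach_trans _ _ _ u); apply: reach1 => //; rewrite (simple_darts_sym _ _ sC).
by apply: (@reach_trans _ _ _ u); apply: reach1 => //; rewrite (simple_darts_sym _ _ sC).
Qed.

(** * Relabelling the vertices *)

Section Relabel.

Variables n s : nat.
Implicit Types (A : {set 'I_n * 'I_n}) (M : lgraph n s) (p q : {perm 'I_n}).

Lemma dmap_inj p : injective (dmap p).
Proof. by move=> [v w] [v' w'] [/perm_inj-> /perm_inj->]. Qed.

Definition rdarts p A := dmap p @: A.

Definition relabel M p : lgraph n s := (rdarts p M.1, [ffun j => p (M.2 j)]).

Lemma mem_rdarts p A v w : ((p v, p w) \in rdarts p A) = ((v, w) \in A).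
Proof. exact: (mem_imset A (v, w) (@dmap_inj p)). Qed.

Lemma relabel1 : relabel^~ 1%g =1 id.
Proof.
move=> [A x]; congr (_, _); last by apply/ffunP=> j; rewrite ffunE perm1.
by rewrite -[RHS]imset_id; apply: eq_imset => -[v w]; rewrite /dmap !perm1.
Qed.

Lemma relabelM M : act_morph relabel M.
Proof.
move=> p q; congr (_, _); last by apply/ffunP=> j; rewrite !ffunE permM.
by rewrite /rdarts -imset_comp; apply: eq_imset => z; rewrite /= /dmap !permM.
Qed.

Canonical relabel_action := TotalAction relabel1 relabelM.

Lemma relabelK p : cancel (relabel^~ p) (relabel^~ p^-1%g).
Proof. exact: (actK relabel_action). Qed.

Lemma card_rdarts p A : #|rdarts p A| = #|A|.
Proof. by rewrite card_imset //; apply: dmap_inj. Qed.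

Lemma rdartsK p A : rdarts p^-1%g (rdarts p A) = A.
Proof.
rewrite /rdarts -imset_comp -[RHS]imset_id; apply: eq_imset => -[v w].
by rewrite /= /dmap !permK.
Qed.

Lemma simple_rdarts p A : simple_darts (rdarts p A) = simple_darts A.
Proof.
suff imp q B : simple_darts B -> simple_darts (rdarts q B).
  by apply/idP/idP=> /imp //; move/(_ p^-1%g); rewrite rdartsK.
move=> /simple_dartsP[irrB symB]; apply/simple_dartsP; split=> [v|v w].
  by rewrite -(permKV q v) mem_rdarts.
by rewrite -(permKV q v) -(permKV q w) !mem_rdarts; apply: symB.
Qed.

Lemma conn_rdarts p A : conn (rdarts p A) = conn A.
Proof.
suff imp q B : conn B -> conn (rdarts q B).
  by apply/idP/idP=> /imp //; move/(_ p^-1%g); rewrite rdartsK.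
move=> /connP cB; apply/connP=> v w; rewrite -(permKV q v) -(permKV q w).
by apply: reach_homo (cB _ _) => x y xyB; apply: reach1; rewrite mem_rdarts.
Qed.

Lemma rdarts_edge p v w : rdarts p (edge_darts v w) = edge_darts (p v) (p w).
Proof. by rewrite /rdarts imsetU !imset_set1. Qed.

Lemma rdarts_cut p A v w : rdarts p (cut A v w) = cut (rdarts p A) (p v) (p w).
Proof.
rewrite /cut -rdarts_edge; apply/setP=> -[x y].
by rewrite -(permKV p x) -(permKV p y) mem_rdarts !in_setD !mem_rdarts.
Qed.

Lemma rdarts_link p A v w : rdarts p (link A v w) = link (rdarts p A) (p v) (p w).
Proof. by rewrite /link -rdarts_edge -imsetU. Qed.

Lemma bridge_rdarts p A v w : bridge (rdarts p A) (p v) (p w) = bridge A v w.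
Proof. by rewrite /bridge mem_rdarts -rdarts_cut conn_rdarts. Qed.

(** For a connected graph cyclomatic number k means n + k - 1 edges; each has two darts. *)
Definition valid k M : bool :=
  [&& simple_darts M.1, conn M.1 & #|M.1| == (n + k).-1.*2].

Lemma valid_relabel k M p : valid k (relabel M p) = valid k M.
Proof. by rewrite /valid /= simple_rdarts conn_rdarts card_rdarts. Qed.

Definition link_lgraph M v w : lgraph n s := (link M.1 v w, M.2).
Definition cut_lgraph M v w : lgraph n s := (cut M.1 v w, M.2).

End Relabel.

(** * Contracting an edge at the last vertex *)

Section Merge.

Variable n : nat.
Implicit Types (i : 'I_n) (v w : 'I_n.+1) (A : {set 'I_n.+1 * 'I_n.+1}).

Definition merge i v : 'I_n := odflt i (unlift (new_vertex n) v).

Lemma old_vertexE (u : 'I_n) : old_vertex u = lift (new_vertex n) u.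
Proof. by apply: val_inj; rewrite /= /bump leqNgt ltn_ord. Qed.

Lemma merge_old i u : merge i (old_vertex u) = u.
Proof. by rewrite old_vertexE /merge liftK. Qed.

Lemma merge_new i : merge i (new_vertex n) = i.
Proof. by rewrite /merge unlift_none. Qed.

Lemma old_vertex_inj : injective (@old_vertex n).
Proof. by move=> u u'; rewrite !old_vertexE; apply: lift_inj. Qed.

Lemma old_neq_new (u : 'I_n) : old_vertex u != new_vertex n.
Proof. by rewrite old_vertexE eq_sym neq_lift. Qed.

Variant vertex_spec : 'I_n.+1 -> Type :=
| VertexOld (u : 'I_n) : vertex_spec (old_vertex u)
| VertexNew : vertex_spec (new_vertex n).

Lemma vertexP v : vertex_spec v.
Proof.
by case: (unliftP (new_vertex n) v) => [u|] ->; rewrite -?old_vertexE; constructor.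
Qed.

Lemma merge_eq i v w :
  merge i v = merge i w -> v != w -> (v, w) \in edge_darts (old_vertex i) (new_vertex n).
Proof.
case: (vertexP v) => [v'|]; case: (vertexP w) => [w'|]; rewrite ?merge_old ?merge_new.
- by move=> ->; rewrite eqxx.
- by move=> -> _; rewrite !inE eqxx.
- by move=> <- _; rewrite !inE eqxx orbT.
- by rewrite eqxx.
Qed.

Definition contract_darts i A : {set 'I_n * 'I_n} :=
  dmap (merge i) @: cut A (old_vertex i) (new_vertex n).

Variables (i : 'I_n) (A : {set 'I_n.+1 * 'I_n.+1}).
Hypothesis sA : simple_darts A.
Hypothesis iA : (old_vertex i, new_vertex n) \in A.

Lemma simple_contract_darts : simple_darts (contract_darts i A).
Proof.
have [irrA symA] := simple_dartsP _ sA.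
have [_ symC] := simple_dartsP _ (simple_darts_cut (old_vertex i) (new_vertex n) sA).
apply/simple_dartsP; split=> [u|u u'].
  apply/negP => /imsetP[[v w]]; rewrite inE => /andP[vwE vwA] [/= -> vw].
  by rewrite (merge_eq vw) ?(simple_darts_irr sA) in vwE.
case/imsetP=> [[v w] /symC wvC [/= -> ->]].
exact: (imset_f (dmap (merge i)) wvC).
Qed.

Hypothesis nocommon : forall u,
  (old_vertex i, u) \in A -> (new_vertex n, u) \in A -> False.

(** Two darts with the same image differ at most by old_vertex i versus the new vertex
    at one end, which makes the other end a common neighbour; a difference at both ends
    would need the contracted edge itself or a loop. *)
Lemma contract_darts_inj :
  {in cut A (old_vertex i) (new_vertex n) &, injective (dmap (merge i))}.
Proof.
set C := cut _ _ _.
have [irrA _] := simple_dartsP _ sA.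
have sC : simple_darts C := simple_darts_cut _ _ sA.
have left v w v' w' : (v, w) \in C -> (v', w') \in C ->
    merge i v = merge i v' -> merge i w = merge i w' -> v = v'.
  move=> vwC vwC' /merge_eq ev /merge_eq ew.
  have [//|/ev {}ev] := eqVneq v v'.
  move: vwC vwC'; rewrite !inE => /andP[vwE vwA] /andP[vwE' vwA'].
  have [ww|/ew {}ew] := eqVneq w w'.
    move: ev; rewrite -ww in vwA'; rewrite !inE => /orP[]/eqP[ev ev'];
    by rewrite ev in vwA; rewrite ev' in vwA'; case: (@nocommon w).
  move: ev ew vwE vwA; rewrite !inE => /orP[]/eqP[-> ev] /orP[]/eqP[-> ew];
  by rewrite ?eqxx ?orbT // (negPf (irrA _)).
move=> [v w] [v' w'] vwC vwC' [/= vE wE]; congr (_, _); first exact: left vE wE.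
by apply: (left w v w' v') => //; rewrite (simple_darts_sym _ _ sC).
Qed.

Lemma card_contract_darts : #|A| = #|contract_darts i A|.+2.
Proof. by rewrite (card_cut sA iA) card_in_imset //; apply: contract_darts_inj. Qed.

(** Walks project along merge; conversely they lift, with a step along the contracted
    edge wherever the two merged vertices have to be exchanged. *)
Lemma conn_contract_darts : conn (contract_darts i A) = conn A.
Proof.
apply/connP/connP=> [cC v w|cA u u']; last first.
  rewrite -(merge_old i u) -(merge_old i u'); apply: reach_homo (cA _ _) => v w vwA.
  have [vwE|vwE] := boolP ((v, w) \in edge_darts (old_vertex i) (new_vertex n)).
    move: vwE; rewrite !inE => /orP[]/eqP[-> ->];
    by rewrite merge_old merge_new; apply: reach_refl.
  by apply/reach1/imsetP; exists (v, w); rewrite // in_setD vwE.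
have toold v' : reach A v' (old_vertex (merge i v')) /\ reach A (old_vertex (merge i v')) v'.
  case: (vertexP v') => [u|]; rewrite ?merge_old ?merge_new; split;
  by [apply: reach_refl|apply: reach1; rewrite // (simple_darts_sym _ _ sA)].
apply: reach_trans (toold v).1 _; apply: reach_trans (toold w).2.
apply: reach_homo (cC _ _) => u u' /imsetP[[x y]]; rewrite inE => /andP[_ xyA] [-> ->] /=.
by apply: reach_trans (toold x).2 _; apply: reach_trans (toold y).1; apply: reach1.
Qed.

End Merge.

Section Contract.

Variables n s : nat.
Implicit Types (i : 'I_n) (N : lgraph n.+1 s) (p : {perm 'I_n}).

Definition contract i N : lgraph n s :=
  (contract_darts i N.1, [ffun j => merge i (N.2 j)]).

(** The graphs that arise by splitting vertex i of a graph of cyclomatic number k. *)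
Definition bridged k i N : bool :=
  valid k N && bridge N.1 (old_vertex i) (new_vertex n).

Lemma valid_contract k i N : bridged k i N -> valid k (contract i N).
Proof.
case/andP=> /and3P[sN cN /eqP kN] bN.
have nc u := bridge_common sN cN bN (u := u); have /andP[iN _] := bN.
rewrite /valid /= (simple_contract_darts _ sN) conn_contract_darts // cN /=.
have := card_contract_darts sN iN nc; have := ltn_ord i; rewrite kN addSn => ltin /=.
by rewrite -[in X in X -> _](@prednK (n + k)) ?doubleS; [case=> ->|lia].
Qed.

(** Relabelling before contraction: the last vertex must stay in place. *)
Definition extend p : {perm 'I_n.+1} := lift_perm (new_vertex n) (new_vertex n) p.

Lemma extend_old p u : extend p (old_vertex u) = old_vertex (p u).
Proof. by rewrite !old_vertexE lift_perm_lift. Qed.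

Lemma extend_new p : extend p (new_vertex n) = new_vertex n.
Proof. exact: lift_perm_id. Qed.

Lemma merge_extend p i v : merge (p i) (extend p v) = p (merge i v).
Proof.
by case: (vertexP v) => [u|]; rewrite ?extend_old ?extend_new ?merge_old ?merge_new.
Qed.

Lemma contract_relabel p i N :
  contract (p i) (relabel N (extend p)) = relabel (contract i N) p.
Proof.
congr (_, _); last by apply/ffunP=> j; rewrite !ffunE merge_extend.
rewrite /contract_darts /= -extend_old -{1}(extend_new p) -rdarts_cut /rdarts -!imset_comp.
by apply: eq_imset => z; rewrite /= /dmap !merge_extend.
Qed.

Lemma bridged_relabel k p i N :
  bridged k (p i) (relabel N (extend p)) = bridged k i N.
Proof.
rewrite /bridged valid_relabel; congr (_ && _); rewrite /=.
by rewrite -[in RHS](bridge_rdarts (extend p)) extend_old extend_new.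
Qed.

End Contract.

(** * Counting edges in an invariant sum over labelled graphs *)

Local Open Scope ring_scope.

Section Counting.

Variables n s : nat.
Implicit Types (f : lgraph n.+1 s -> rat) (M N : lgraph n.+1 s).

(** Invariance is asked for on simple connected graphs only: link_sum treats the two
    darts of an edge asymmetrically, so it is not invariant on arbitrary sets of darts. *)
Definition invariant m k (f : lgraph m s -> rat) :=
  forall (M : lgraph m s) p, valid k M -> f (relabel M p) = f M.

Lemma sum_relabel m (D : pred (lgraph m s)) (F : lgraph m s -> rat) (p : {perm 'I_m}) :
  \sum_(M | D M) F M = \sum_(M | D (relabel M p)) F (relabel M p).
Proof. by apply: reindex_inj; exact: can_inj (relabelK p). Qed.

Lemma sum_half m (F : 'I_m -> 'I_m -> rat) : (forall v w, F v w = F w v) ->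
  \sum_(v < m) \sum_(w < m | (w < v)%N) F v w = 2^-1 * \sum_v \sum_(w | w != v) F v w.
Proof.
move=> symF; suff -> : \sum_v \sum_(w | w != v) F v w =
    2 * \sum_(v < m) \sum_(w < m | (w < v)%N) F v w by rewrite mulKf.
rewrite mulr_natl mulr2n [X in _ = _ + X](exchange_big_dep predT) //= -big_split /=.
apply: eq_bigr => v _; rewrite (bigID (fun w : 'I_m => (w < v)%N)) /=.
congr (_ + _); last rewrite [RHS](eq_bigr (F v)) //; apply: eq_bigl => w.
  by rewrite neq_ltn; case: ltngtP.
by rewrite -leqNgt neq_ltn; case: ltngtP.
Qed.

(** Since f is invariant, transposing the last vertex with v shows that, weighted by f,
    the last vertex meets as many bridges as v. It thus accounts for the fraction
    1 / (n + 1) of all darts that run along bridges. *)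
Lemma sum_bridged k f : invariant k f ->
  \sum_(i < n) \sum_(N | bridged k i N) f N =
  n.+1%:R^-1 * \sum_(N | valid k N) f N * (\sum_v \sum_w bridge N.1 v w)%N%:R.
Proof.
move=> invf; pose T v := \sum_(N | valid k N) f N * (\sum_w bridge N.1 v w)%N%:R.
have TE v w : T v = T w.
  rewrite /T (sum_relabel _ _ (tperm w v)); apply: eq_big => N.
    by rewrite valid_relabel.
  rewrite valid_relabel => vN; rewrite invf //; congr (_ * _%:R).
  rewrite (reindex_inj (@perm_inj _ (tperm w v))); apply: eq_bigr => u _ /=.
  by rewrite -[in RHS](bridge_rdarts (tperm w v)) tpermL.
transitivity (T (new_vertex n)).
  rewrite (exchange_big_dep (valid k)) /= => [|i N _ /andP[]] //.
  apply: eq_bigr => N vN; rewrite /bridged vN /=.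
  have [sN _ _] := and3P vN.
  rewrite sumr_const -[LHS]mulr_natr; congr (_ * _%:R).
  rewrite big_ord_recr /= bridge_irr // addn0 -sum1_card big_mkcond.
  by apply: eq_bigr => i _; rewrite bridgeC //; rewrite /bridge -topredE /=; case: (_ && _).
have -> : \sum_(N | valid k N) f N * (\sum_v \sum_w bridge N.1 v w)%N%:R = \sum_v T v.
  by rewrite exchange_big; apply: eq_bigr => N _; rewrite -mulr_sumr natr_sum.
rewrite (eq_bigr (fun=> T (new_vertex n))) => [|v _]; last exact: TE.
by rewrite sumr_const card_ord -[X in _ * X]mulr_natl mulKf // pnatr_eq0.
Qed.

Lemma sum_contract k i f :
  \sum_(M : lgraph n s | valid k M) \sum_(N | bridged k i N && (contract i N == M)) f N =
  \sum_(N | bridged k i N) f N.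
Proof. by rewrite [RHS](partition_big (contract i) (valid k)) // => N; apply: valid_contract. Qed.

(** Adjoint of the split-and-join part of the recursion: by sum_split, its value at the
    skeleton of G is the sum of f over all the graphs that this part produces from G. *)
Definition contraction_sum k f (M : lgraph n s) : rat :=
  \sum_(i < n) \sum_(N | bridged k i N && (contract i N == M)) f N.

Lemma contraction_sum_invariant k f : invariant k f -> invariant k (contraction_sum k f).
Proof.
move=> invf M p vM; rewrite /contraction_sum (reindex_inj (@perm_inj _ p)) /=.
apply: eq_bigr => i _; rewrite (sum_relabel _ _ (extend p)).
apply: eq_big => N; rewrite bridged_relabel contract_relabel.
  by rewrite (inj_eq (can_inj (relabelK p))).
by case/andP=> /andP[vN _] _; apply: invf.
Qed.

End Counting.

Section LinkSums.

Variables n s : nat.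
Implicit Types (f : lgraph n s -> rat) (M N : lgraph n s).

(** Adjoint of the edge-insertion part of the recursion. *)
Definition link_sum f M : rat :=
  \sum_(v < n) \sum_(w < n | (w < v)%N)
     if (v, w) \in M.1 then 0 else f (link_lgraph M v w).

Lemma link_sumE f M : simple_darts M.1 -> link_sum f M =
  2^-1 * \sum_v \sum_(w | w != v) if (v, w) \in M.1 then 0 else f (link_lgraph M v w).
Proof.
move=> sM; apply: sum_half => v w; rewrite (simple_darts_sym v w sM) /link_lgraph.
by rewrite linkC.
Qed.

Lemma valid_link k M v w : v != w -> (v, w) \notin M.1 -> valid k M ->
  valid k.+1 (link_lgraph M v w).
Proof.
move=> vw nvw /and3P[sM cM /eqP kM].
rewrite /valid simple_darts_link // conn_link // card_link // kM /=.
by rewrite addnS /= -doubleS prednK // addn_gt0 (leq_ltn_trans _ (ltn_ord v)).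
Qed.

Lemma valid_cut k N v w : valid k.+1 N -> nonbridge N.1 v w -> valid k (cut_lgraph N v w).
Proof.
move=> /and3P[sN cN /eqP kN] /andP[vwN cC].
rewrite /valid simple_darts_cut // cC /=.
have := card_cut sN vwN; rewrite kN addnS /=; have := ltn_ord v.
by case: (n + k)%N => [|m] //; rewrite doubleS /= => _ [->].
Qed.

Lemma link_sum_invariant k f : invariant k.+1 f -> invariant k (link_sum f).
Proof.
move=> invf M p vM; have [sM _ _] := and3P vM.
rewrite !link_sumE ?simple_rdarts //; congr (_ * _).
rewrite (reindex_inj (@perm_inj _ p)) /=; apply: eq_bigr => v _.
rewrite (reindex_inj (@perm_inj _ p)) /=; apply: eq_big => w; first by rewrite (inj_eq perm_inj).
move=> pwv; rewrite mem_rdarts; case: ifPn => // nvw.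
have -> : link_lgraph (relabel M p) (p v) (p w) = relabel (link_lgraph M v w) p.
  by rewrite /relabel /link_lgraph /= rdarts_link.
by apply/invf/valid_link => //; apply: contraNneq pwv => ->.
Qed.

(** The pairs of a connected graph and a non-adjacent pair v, w correspond to the pairs of
    a graph and a non-bridge; the factor 1/2 is there because both darts of an edge are
    counted on the right. *)
Lemma sum_link k f :
  \sum_(M | valid k M) link_sum f M =
  2^-1 * \sum_(N | valid k.+1 N) f N * (\sum_v \sum_w nonbridge N.1 v w)%N%:R.
Proof.
rewrite (eq_bigr _ (fun M vM => link_sumE f (andP vM).1)) -mulr_sumr; congr (_ * _).
rewrite exchange_big [RHS](eq_bigr (fun N : lgraph n s =>
  \sum_v \sum_w f N * (nonbridge N.1 v w)%N%:R)) => [|N _]; last first.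
  by rewrite natr_sum mulr_sumr; apply: eq_bigr => v _; rewrite natr_sum mulr_sumr.
rewrite [RHS]exchange_big; apply: eq_bigr => v _.
rewrite exchange_big [RHS]exchange_big [RHS](bigID (fun w => w != v)) /= [X in _ + X]big1.
  rewrite addr0; apply: eq_bigr => w wv; rewrite eq_sym in wv.
  transitivity (\sum_(M | valid k M && ((v, w) \notin M.1)) f (link_lgraph M v w)).
    by rewrite [RHS]big_mkcondr; apply: eq_bigr => M _; rewrite if_neg.
  transitivity (\sum_(N | valid k.+1 N && nonbridge N.1 v w) f N); last first.
    rewrite [LHS]big_mkcondr; apply: eq_bigr => N _.
    by case: nonbridge; rewrite ?mulr1 ?mulr0.
  rewrite [RHS](reindex_onto (fun M => link_lgraph M v w) (fun N => cut_lgraph N v w)).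
    apply: eq_bigl => M; apply/andP/andP=> [[vM nvw]|[/andP[vN nN] /eqP <-]].
      have /and3P[sM cM _] := vM.
      rewrite valid_link // /nonbridge /link_lgraph /cut_lgraph /= cut_link // cM.
      by rewrite !inE eqxx; case: (M).
    by split; [apply: valid_cut|rewrite !inE eqxx].
  move=> N /andP[/and3P[sN _ _] /andP[vwN _]].
  by rewrite /link_lgraph /cut_lgraph /= link_cut //; case: (N).
move=> w /negbNE/eqP->; apply: big1 => N /and3P[/simple_dartsP[irrN _] _ _].
by rewrite /nonbridge (negPf (irrN v)) mulr0.
Qed.

(** Deleting a non-bridge leaves a connected graph, but there are already as few edges as
    connectedness permits. *)
Lemma nonbridge_tree N v w : valid 0 N -> nonbridge N.1 v w = false.
Proof.
move=> /and3P[sN _ /eqP kN]; apply/negP => /andP[vwN cC].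
have := conn_card (simple_darts_cut v w sN) cC.
by rewrite -ltnS -ltnS -(card_cut sN vwN) kN addn0 ltnNge leqnSn.
Qed.

End LinkSums.

Lemma valid_two k s (N : lgraph 2 s) : valid k N -> k = 0%N.
Proof.
case/and3P=> sN _ /eqP kN; have := simple_darts_card sN; rewrite kN; lia.
Qed.

(** * Skeletons of graphs with ends *)

Section Skeleton.

Variables n s : nat.
Implicit Types (G H : egraph n s) (p : {perm 'I_n}).

Definition opp_end (m : nat) (d : 'I_m * bool) := (d.1, ~~ d.2).

Lemma opp_endK m : involutive (@opp_end m).
Proof. by case=> a b; rewrite /opp_end /= negbK. Qed.

Lemma opp_end_neq m (d : 'I_m * bool) : opp_end d != d.
Proof. by case: d => a []; rewrite xpair_eqE eqxx. Qed.

Definition dart G (d : 'I_(nint G) * bool) : 'I_n * 'I_n :=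
  (iatt G d, iatt G (opp_end d)).

(** The graph without the names of its ends. On simple graphs nothing else is lost. *)
Definition skel G : lgraph n s := ([set dart d | d : 'I_(nint G) * bool], xatt G).

Lemma dart_skel G (d : 'I_(nint G) * bool) : dart d \in (skel G).1.
Proof. exact: imset_f. Qed.

Lemma skel_adj G v w : ((v, w) \in (skel G).1) = adj G v w.
Proof.
apply/imsetP/existsP=> [[[a b] _ [-> ->]]|[a /existsP[b /andP[/eqP<- /eqP<-]]]].
  by exists a; apply/existsP; exists b; rewrite !eqxx.
by exists (a, b).
Qed.

Lemma skel_sym G v w : (v, w) \in (skel G).1 -> (w, v) \in (skel G).1.
Proof.
by case/imsetP=> d _ [-> ->]; apply/imsetP; exists (opp_end d); rewrite // /dart opp_endK.
Qed.

Lemma conn_skel G : connected_graph G = conn (skel G).1.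
Proof.
apply: eq_forallb => v; apply: eq_forallb => w; apply: eq_connect => x y.
by rewrite skel_adj.
Qed.

(** Loops and multiple edges are exactly the coincidences between darts. *)
Lemma simple_graphP G : reflect (injective (@dart G)) (simple_graph G).
Proof.
apply: (iffP andP) => [[nl nm] d d' dd'|injd]; last first.
  split; apply/negP.
    case/existsP=> a /eqP aa.
    by have := injd (a, false) (a, true); rewrite /dart /opp_end /= aa => /(_ erefl).
  case/existsP=> v /existsP[w /existsP[a /existsP[b /and4P[vw ab ja jb]]]].
  case/existsP: ja => c /andP[/eqP cv /eqP cw].
  case/existsP: jb => c' /andP[/eqP cv' /eqP cw'].
  have := injd (a, c) (b, c'); rewrite /dart /opp_end /= cv cw cv' cw' => /(_ erefl)[ab' _].
  by rewrite ab' eqxx in ab.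
case: d d' dd' => [a c] [b c'] [/= cv cw].
have ll e : iatt G (e, false) != iatt G (e, true).
  by apply: contraNneq nl => ee; apply/existsP; exists e; rewrite ee.
have [ab|ab] := eqVneq a b.
  rewrite -ab in cv *; case: c c' cv {cw} => -[] // /esym/eqP; rewrite ?(negPf (ll a)) //.
  by rewrite eq_sym (negPf (ll a)).
case/negP: nm; apply/existsP; exists (iatt G (a, c)); apply/existsP; exists (iatt G (a, ~~ c)).
apply/existsP; exists a; apply/existsP; exists b; apply/and4P; split=> //.
- by case: c {cv cw} => //=; rewrite eq_sym.
- by apply/existsP; exists c; rewrite !eqxx.
- by apply/existsP; exists c'; rewrite cv cw !eqxx.
Qed.

(** The skeleton and the number of edges, both invariant under renaming of the ends,
    suffice to recognize simple graphs. *)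
Lemma simple_card G : simple_graph G = (#|(skel G).1| == (nint G).*2).
Proof.
have E : #|{: 'I_(nint G) * bool}| = (nint G).*2 by rewrite card_prod card_ord card_bool muln2.
apply/simple_graphP/eqP=> [inj|eqc]; first by rewrite card_imset.
have /imset_injP inj : #|[set dart d | d : 'I_(nint G) * bool]| == #|{: 'I_(nint G) * bool}|.
  by rewrite E -eqc.
by move=> d d'; apply: inj.
Qed.

Lemma skel_simple G : simple_graph G -> simple_darts (skel G).1.
Proof.
move/simple_graphP=> inj; apply/simple_dartsP; split=> [v|]; last exact: skel_sym.
apply/imsetP=> -[d _ [vd vd']].
have /inj/eqP : dart (opp_end d) = dart d by rewrite /dart opp_endK -vd -vd'.
by rewrite (negPf (opp_end_neq d)).
Qed.

Section IsoDarts.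

Variables (G H : egraph n s) (p : {perm 'I_n}) (f : {ffun ends G -> ends H}).
Hypothesis isof : is_iso p f.

(** An isomorphism maps edges to edges, hence opposite ends to opposite ends. *)
Lemma iso_inl (d : 'I_(nint G) * bool) : exists d' : 'I_(nint H) * bool,
  [/\ f (inl d) = inl d', f (inl (opp_end d)) = inl (opp_end d') &
      dart d' = dmap p (dart d)].
Proof.
have [fB fi _ fa _] := is_isoP _ _ isof; have fI := bij_inj fB.
case: d => a c.
have /fi/imsetP[b _ fE] : [set inl (a, false); inl (a, true)] \in iedges G.
  by apply/imsetP; exists a.
have inE' c' : f (inl (a, c')) \in [set (inl (b, false) : ends H); inl (b, true)].
  by rewrite -fE; apply: imset_f; rewrite !inE; case: c'; rewrite eqxx ?orbT.
have [c' fc'] : exists c', f (inl (a, c)) = inl (b, c').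
  by have := inE' c; rewrite !inE => /orP[]/eqP->; [exists false|exists true].
have fc'' : f (inl (a, ~~ c)) = inl (b, ~~ c').
  have nfc : f (inl (a, ~~ c)) != f (inl (a, c)).
    by apply/eqP=> /fI[/esym]; case: (c).
  have := inE' (~~ c); rewrite !inE => /orP[]/eqP fE'; rewrite fE' fc' in nfc *;
  by case: (c') nfc; rewrite ?eqxx.
exists (b, c'); split=> //.
have := fa (inl (a, c)); have := fa (inl (a, ~~ c)); rewrite fc' fc'' /=.
by move=> [e1] [e2]; rewrite /dart /dmap /opp_end /= e1 e2.
Qed.

(** Labels are preserved, so an external edge can only go to the one of the same label,
    free end to free end. *)
Lemma iso_inr y : f (inr y) = inr y.
Proof.
have [fB _ fx _ ff] := is_isoP _ _ isof; have fI := bij_inj fB.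
case: y => j []; first exact: ff.
have /fx/imsetP[j' _ fE] : [set inr (j, false); inr (j, true)] \in xedges G.
  by apply/imsetP; exists j.
have : f (inr (j, true)) \in [set (inr (j', false) : ends H); inr (j', true)].
  by rewrite -fE; apply: imset_f; rewrite !inE eqxx orbT.
rewrite [f _](ff j) !inE => /orP[]/eqP[] // jj'; rewrite -{}jj' in fE.
have : f (inr (j, false)) \in [set (inr (j, false) : ends H); inr (j, true)].
  by rewrite -fE; apply: imset_f; rewrite !inE eqxx.
rewrite !inE => /orP[/eqP-> //|/eqP fj].
by have /fI : f (inr (j, false)) = f (free_end G j) by rewrite ff fj.
Qed.

Lemma iso_nint : nint G = nint H.
Proof.
have [fB _ _ _ _] := is_isoP _ _ isof; have /eqP := bij_eq_card fB.
by rewrite !card_sum !card_prod !card_ord card_bool eqn_add2r eqn_pmul2r // => /eqP.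
Qed.

Lemma iso_darts_sub : rdarts p (skel G).1 \subset (skel H).1.
Proof.
apply/subsetP=> _ /imsetP[_ /imsetP[d _ ->] ->].
by have [d' [_ _ <-]] := iso_inl d; apply: imset_f.
Qed.

End IsoDarts.

Lemma iso_skel G H p (f : {ffun ends G -> ends H}) :
  is_iso p f -> skel H = relabel (skel G) p.
Proof.
move=> isof; have [g isog] := is_iso_inv isof.
have [_ _ _ fa _] := is_isoP _ _ isof.
have e1 : (skel H).1 = rdarts p (skel G).1.
  apply/eqP; rewrite eqEsubset (iso_darts_sub isof) andbT.
  rewrite -{1}(rdartsK p^-1%g (skel H).1) invgK; apply: imsetS.
  exact: iso_darts_sub isog.
have e2 : (skel H).2 = [ffun j => p ((skel G).2 j)].
  apply/ffunP=> j; rewrite ffunE; have := fa (inr (j, false)).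
  by rewrite (iso_inr isof) => -[].
by rewrite /relabel -e1 -e2.
Qed.

Lemma iso_simple G H p (f : {ffun ends G -> ends H}) :
  is_iso p f -> simple_graph H = simple_graph G.
Proof.
by move=> isof; rewrite !simple_card (iso_skel isof) (iso_nint isof) card_rdarts.
Qed.

(** In H every dart belongs to exactly one end; each end of G is sent to the end of H
    whose dart is the relabelled one. *)
Lemma iso_of_skel G H p : simple_graph G -> simple_graph H ->
  skel H = relabel (skel G) p -> exists f : {ffun ends G -> ends H}, is_iso p f.
Proof.
move=> sG sH eqs; have injG := simple_graphP _ sG; have injH := simple_graphP _ sH.
have [eqd eqx] : (skel H).1 = rdarts p (skel G).1 /\ forall j, xatt H j = p (xatt G j).
  split; first by rewrite eqs.
  by move=> j; have /(congr1 snd)/ffunP/(_ j) := eqs; rewrite /= ffunE.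
have ex (d : 'I_(nint G) * bool) : exists d', dart (G := H) d' = dmap p (dart d).
  have : dmap p (dart d) \in (skel H).1 by rewrite eqd; apply: imset_f; apply: dart_skel.
  by case/imsetP=> d' _ ->; exists d'.
have [g gP] := fin_all_exists ex.
have gopp d : g (opp_end d) = opp_end (g d).
  apply: injH; rewrite gP; case: (gP d) => e1 e2.
  by rewrite /dart /dmap /= !opp_endK e1 e2.
have gI : injective g.
  move=> d d' eg; apply: injG; apply: (@dmap_inj _ p).
  by rewrite -!gP eg.
pose h (x : ends G) : ends H := match x with inl d => inl (g d) | inr y => inr y end.
have hI : injective h by move=> [d|y] [d'|y'] //= [] => [/gI->|->].
exists [ffun x => h x]; apply/is_isoP.
have E (e : {set ends G}) : [ffun x => h x] @: e = h @: e.
  by apply: eq_imset => x; rewrite ffunE.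
split=> [|e|e|x|j]; rewrite ?E ?ffunE //.
- have bh : bijective h.
    apply: inj_card_bij => //; rewrite !card_sum leq_add2r !card_prod !card_ord card_bool.
    move: sG sH; rewrite !simple_card eqs card_rdarts => /eqP-> /eqP.
    by rewrite !muln2 => ->.
  by apply: (eq_bij bh) => x; rewrite ffunE.
- case/imsetP=> a _ ->; rewrite imsetU !imset_set1 /=.
  rewrite -[(a, true)]/(opp_end (a, false)) gopp.
  case: (g (a, false)) => b c; apply/imsetP; exists b => //.
  by case: c; rewrite // setUC.
- case/imsetP=> j _ ->; rewrite imsetU !imset_set1 /=.
  by apply/imsetP; exists j.
- case: x => [d|[j []]] //=; last by rewrite eqx.
  by congr Some; case: (gP d).
Qed.

(** The dart of the image of an end is prescribed by p, and H has only one end with that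
    dart. Hence automorphisms may be counted by their action on vertices alone. *)
Lemma iso_unique G H p (f f' : {ffun ends G -> ends H}) :
  simple_graph H -> is_iso p f -> is_iso p f' -> f = f'.
Proof.
move=> /simple_graphP injH isof isof'; apply/ffunP=> -[d|y]; last by rewrite !(iso_inr (p := p)).
have [d1 [-> _ e1]] := iso_inl isof d; have [d2 [-> _ e2]] := iso_inl isof' d.
by congr inl; apply: injH; rewrite e1 e2.
Qed.

Lemma iso_orbit G H : simple_graph G -> simple_graph H ->
  iso G H = (skel H \in orbit (relabel_action n s) setT (skel G)).
Proof.
move=> sG sH; apply/existsP/orbitP=> [[p /existsP[f /iso_skel->]]|[p _ eqs]]; exists p => //.
by apply/existsP/iso_of_skel.
Qed.

Lemma symfactor_stab G : simple_graph G ->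
  symfactor G = #|'C_setT[skel G | relabel_action n s]%g|.
Proof.
move=> sG; rewrite /symfactor -(card_in_imset (f := fst)) => [|[p f] [q g]]; last first.
  rewrite !inE /= => isof isog pq; rewrite -pq in isog *.
  by rewrite (iso_unique sG isof isog).
apply: eq_card => p; rewrite in_setI in_setT /=.
apply/imsetP/astab1P=> [[[q f]]|eqs].
  by rewrite inE /= => /iso_skel eqs ->; apply: esym eqs.
have [f isof] := iso_of_skel sG sG (esym eqs).
by exists (p, f); rewrite ?inE.
Qed.

(** Orbit-stabiliser: the isomorphism class of G contains n! / S graphs. *)
Lemma card_orbit_symfactor G : simple_graph G ->
  (#|orbit (relabel_action n s) setT (skel G)| * symfactor G)%N = n`!.
Proof. by move=> sG; rewrite symfactor_stab // card_orbit_stab cardsT card_Sn. Qed.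

End Skeleton.

Lemma skel_add_edge n s (G : egraph n s) (v w : 'I_n) :
  skel (add_edge G v w) = link_lgraph (skel G) v w.
Proof.
congr (_, _); apply/setP=> z; rewrite !inE.
have old_dart (a : 'I_(nint G)) b :
    dart (G := add_edge G v w) (lift ord_max a, b) = dart (a, b).
  by rewrite /dart /iatt /= !ffunE /= !liftK.
have new_dart b : dart (G := add_edge G v w) (ord_max, b) = if b then (w, v) else (v, w).
  by rewrite /dart /iatt /= !ffunE /= !unlift_none; case: b.
apply/imsetP/idP=> [[[a b] _ ->]|/orP[/orP[]/eqP->|/imsetP[[a b] _ ->]]].
- case: (unliftP ord_max a) => [a'|] ->; last by rewrite new_dart; case: b; rewrite eqxx ?orbT.
  by rewrite old_dart imset_f ?orbT.
- by exists (ord_max, false); rewrite ?new_dart.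
- by exists (ord_max, true); rewrite ?new_dart.
- by exists (lift ord_max a, b); rewrite ?old_dart.
Qed.

(** * Splitting a vertex inverts contracting a bridge *)

Section Split.

Variables (n s k : nat) (G : egraph n s) (i : 'I_n).
Hypotheses (sG : simple_graph G) (vG : valid k (skel G)).

Let S (E : {set ends G}) := split_vertex E.

Definition rejoin (E : {set ends G}) : lgraph n.+1 s :=
  link_lgraph (skel (S E)) (old_vertex i) (new_vertex n).

(** The ends that must be moved to recover N: those whose edge leads, in N, from
    the new vertex to the place of the opposite end. *)
Definition moved_ends (N : lgraph n.+1 s) : {set ends G} :=
  [set x | match x with
           | inl d => (iatt G d == i) &&
                      ((new_vertex n, old_vertex (iatt G (opp_end d))) \in N.1)
           | inr (j, false) => N.2 j == new_vertex n
           | inr (j, true) => false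
           end].

Let mv (E : {set ends G}) x (v : 'I_n) := if x \in E then new_vertex n else old_vertex v.

Lemma iatt_split E d : iatt (S E) d = mv E (inl d) (iatt G d).
Proof. by rewrite /iatt /= ffunE. Qed.

Lemma xatt_split E j : xatt (S E) j = mv E (inr (j, false)) (xatt G j).
Proof. by rewrite /xatt /= ffunE. Qed.

Lemma no_loop d : iatt G d != iatt G (opp_end d).
Proof. exact: simple_darts_irr (skel_simple sG) (dart_skel d). Qed.

Section Forward.

Variable E : {set ends G}.
Hypothesis Ei : E \subset ends_at G i.

Lemma moved_inl d : inl d \in E -> iatt G d = i.
Proof. by move/(subsetP Ei); rewrite inE => /eqP[]. Qed.

Lemma merge_split d : merge i (iatt (S E) d) = iatt G d.
Proof.
rewrite iatt_split /mv; case: ifP => [/moved_inl->|_]; [exact: merge_new|exact: merge_old].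
Qed.

(** Merging the two halves of the split vertex undoes the split. *)
Lemma dmap_merge_split d : dmap (merge i) (dart (G := S E) d) = dart (G := G) d.
Proof. by rewrite /dmap /dart /= !merge_split. Qed.

Lemma split_inj : injective (dart (G := S E)).
Proof.
move=> d d' dd'; apply: (simple_graphP _ sG).
by rewrite -!dmap_merge_split dd'.
Qed.

Lemma split_simple : simple_darts (skel (S E)).1.
Proof. exact/skel_simple/simple_graphP/split_inj. Qed.

Lemma split_nedge : (old_vertex i, new_vertex n) \notin (skel (S E)).1.
Proof.
apply/imsetP=> -[d _ dE]; have := no_loop d.
by have := dmap_merge_split d; rewrite -dE /dmap /= merge_old merge_new => -[<- <-]; rewrite eqxx.
Qed.

Lemma rejoin_simple : simple_darts (rejoin E).1.
Proof. exact: simple_darts_link (old_neq_new i) split_simple. Qed.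

Lemma cut_rejoin : cut (rejoin E).1 (old_vertex i) (new_vertex n) = (skel (S E)).1.
Proof. exact: cut_link split_simple split_nedge. Qed.

Lemma rejoin_edge : (old_vertex i, new_vertex n) \in (rejoin E).1.
Proof. by rewrite !inE eqxx. Qed.

(** Two such edges would have the same dart once the halves are merged, so they would be
    the same edge of G, whose end at i cannot sit at both halves. *)
Lemma rejoin_nocommon u :
  (old_vertex i, u) \in (rejoin E).1 -> (new_vertex n, u) \in (rejoin E).1 -> False.
Proof.
have [irrR _] := simple_dartsP _ rejoin_simple => iu nu.
have ui : u != old_vertex i by apply: contraTneq iu => ->.
have un : u != new_vertex n by apply: contraTneq nu => ->.
have inS v : (v, u) \in (rejoin E).1 -> (v, u) \in (skel (S E)).1.
  by rewrite -cut_rejoin !inE !xpair_eqE (negPf ui) (negPf un) !andbF.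
have /imsetP[d _ dE] := inS _ iu; have /imsetP[d' _ dE'] := inS _ nu.
have dd' : dart (G := G) d = dart (G := G) d'.
  by rewrite -!dmap_merge_split -dE -dE' /dmap /= merge_old merge_new.
move: dE'; rewrite -(simple_graphP _ sG _ _ dd') -dE => /(congr1 fst)/eqP.
by rewrite eq_sym (negPf (old_neq_new i)).
Qed.

Lemma contract_rejoin : contract i (rejoin E) = skel G.
Proof.
congr (_, _); last first.
  apply/ffunP=> j; rewrite ffunE [(rejoin E).2 j]xatt_split /mv.
  case: ifP => [/(subsetP Ei)|_]; last by rewrite merge_old.
  by rewrite inE => /eqP[->]; rewrite merge_new.
rewrite /contract_darts cut_rejoin -imset_comp; apply: eq_imset => d.
exact: dmap_merge_split.
Qed.

Lemma bridged_rejoin : bridged k i (rejoin E) = ~~ connected_graph (S E).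
Proof.
have [_ cG /eqP kG] := and3P vG.
have cardR := card_contract_darts rejoin_simple rejoin_edge rejoin_nocommon.
have connR := conn_contract_darts rejoin_simple rejoin_edge.
have eqc : contract_darts i (rejoin E).1 = (skel G).1 by rewrite -contract_rejoin.
rewrite /bridged /valid rejoin_simple -connR // eqc cG cardR eqc kG /=.
rewrite /bridge rejoin_edge cut_rejoin -conn_skel /=.
by rewrite -doubleS prednK ?eqxx // addn_gt0 (leq_ltn_trans _ (ltn_ord i)).
Qed.

Lemma moved_rejoin : moved_ends (rejoin E) = E.
Proof.
apply/setP=> -[d|[j []]]; rewrite inE; last first.
- rewrite [(rejoin E).2 j]xatt_split /mv; case: ifP; rewrite ?eqxx //.
  by rewrite (negPf (old_neq_new _)).
- by apply/esym/negP=> /(subsetP Ei); rewrite inE.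
apply/andP/idP=> [[/eqP di]|dE]; last first.
  have di := moved_inl dE; rewrite di; split=> //.
  have ndE : inl (opp_end d) \notin E.
    apply/negP=> /moved_inl di'; have := no_loop d.
    by rewrite di di' eqxx.
  have := dart_skel (G := S E) d; rewrite {1}/dart !iatt_split /mv dE (negPf ndE) => dS.
  by rewrite inE dS orbT.
have nl := no_loop d; rewrite di in nl.
have dn : old_vertex (iatt G (opp_end d)) != old_vertex i.
  by rewrite (inj_eq (@old_vertex_inj n)) eq_sym.
rewrite !inE !xpair_eqE (negPf dn) (negPf (old_neq_new _)) !andbF /= => /imsetP[d' _ [d1 d2]].
have dE' : inl d' \in E.
  move/eqP: d1; rewrite iatt_split /mv; case: ifP => // _.
  by rewrite eq_sym (negPf (old_neq_new _)).
suff -> : d = d' by [].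
apply: (simple_graphP _ sG); have := dmap_merge_split d'.
by rewrite {1}/dart -d1 -d2 /dmap /= merge_new merge_old => <-; rewrite /dart di.
Qed.

End Forward.

Section Backward.

Variable N : lgraph n.+1 s.
Hypotheses (bN : bridged k i N) (cN : contract i N = skel G).

Lemma moved_ends_at : moved_ends N \subset ends_at G i.
Proof.
apply/subsetP=> -[d|[j []]]; rewrite !inE //=; first by case/andP=> /eqP->.
move/eqP=> Nj; have /(congr1 snd)/ffunP/(_ j) := cN.
by rewrite /= ffunE Nj merge_new => ->.
Qed.

(** The split by moved_ends puts an end of G back to the vertex v at which it is in N. If v
    is old_vertex i, the end must not be moved: moved_ends would move it only if w were
    also adjacent to the new vertex, but the two ends of a bridge have no common
    neighbour. *)
Lemma split_moved v w d : (v, w) \in cut N.1 (old_vertex i) (new_vertex n) ->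
  iatt G d = merge i v -> iatt G (opp_end d) = merge i w ->
  iatt (S (moved_ends N)) d = v.
Proof.
have /andP[/and3P[sN conN _] brN] := bN; have [irrN _] := simple_dartsP _ sN.
move=> + dv dw; rewrite in_setD !inE !xpair_eqE negb_or => /andP[/andP[nvw nwv] vwN].
rewrite iatt_split /mv inE dv dw.
case: (vertexP w) nvw nwv vwN {dw} => [w'|]; rewrite ?merge_old ?merge_new.
  case: (vertexP v) {dv} => [u|] _ _ vwN; rewrite ?merge_old ?merge_new ?eqxx ?vwN //.
  case: eqP => //= ui; rewrite ui in vwN *; case: ifP => // nw'.
  by case: (bridge_common sN conN brN vwN nw').
case: (vertexP v) {dv} => [u|] nvw _ vwN; last by rewrite (negPf (irrN _)) in vwN.
rewrite merge_old; case: eqP => //= ui; by rewrite ui !eqxx in nvw.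
Qed.

Lemma dart_split_moved v w d : (v, w) \in cut N.1 (old_vertex i) (new_vertex n) ->
  dart (G := G) d = dmap (merge i) (v, w) -> dart (G := S (moved_ends N)) d = (v, w).
Proof.
have /andP[/and3P[sN _ _] _] := bN.
have sC := simple_darts_cut (old_vertex i) (new_vertex n) sN.
move=> vwC [dv dw]; congr (_, _); first exact: split_moved vwC dv dw.
by apply: (@split_moved w v); rewrite ?opp_endK // (simple_darts_sym _ _ sC).
Qed.

Lemma skel_split_moved :
  skel (S (moved_ends N)) = cut_lgraph N (old_vertex i) (new_vertex n).
Proof.
congr (_, _); last first.
  apply/ffunP=> j; rewrite [LHS]xatt_split /mv inE.
  have /(congr1 snd)/ffunP/(_ j) := cN; rewrite /= ffunE => <-.
  by case: (vertexP (N.2 j)) => [u|]; rewrite ?merge_old ?eqxx // (negPf (old_neq_new _)).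
apply/setP=> -[v w]; apply/imsetP/idP=> [[d _ ->]|vwC]; last first.
  have : dmap (merge i) (v, w) \in (skel G).1 by rewrite -cN; apply: imset_f.
  by case/imsetP=> d _ dE; exists d; rewrite // (dart_split_moved vwC).
have : dart (G := G) d \in (contract i N).1 by rewrite cN; apply: dart_skel.
by case/imsetP=> -[x y] xyC /(dart_split_moved xyC) ->.
Qed.

Lemma rejoin_moved : rejoin (moved_ends N) = N.
Proof.
have /andP[/and3P[sN _ _] /andP[iN _]] := bN.
by rewrite /rejoin skel_split_moved /link_lgraph /cut_lgraph /= link_cut //; case: (N).
Qed.

End Backward.

(** rejoin and moved_ends are mutually inverse, and the split graph is disconnected
    exactly if the edge that rejoins its halves is a bridge. *)
Lemma sum_split (F : lgraph n.+1 s -> rat) :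
  \sum_(E : {set ends G} * {set ends G} |
      [&& E.1 :&: E.2 == set0, E.1 :|: E.2 == ends_at G i &
          ~~ connected_graph (split_vertex E.2)]) F (rejoin E.2) =
  \sum_(N | bridged k i N && (contract i N == skel G)) F N.
Proof.
rewrite (reindex_onto (fun N => (ends_at G i :\: moved_ends N, moved_ends N))
                      (fun E => rejoin E.2)) /=.
  have disj N : (ends_at G i :\: moved_ends N) :&: moved_ends N == set0.
    by rewrite setI_eq0 disjoints_subset setDE subsetIr.
  apply: eq_big => [N|N]; last by case/andP=> _ /eqP->.
  apply/andP/andP=> [[/and3P[_ cover dis] /eqP NE]|[bN /eqP cN]].
    have Ei : moved_ends N \subset ends_at G i by rewrite -(eqP cover) subsetUr.
    by rewrite -NE bridged_rejoin // contract_rejoin.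
  have Ei := moved_ends_at cN; rewrite rejoin_moved // disj; split=> //=.
  rewrite -bridged_rejoin // rejoin_moved // bN andbT.
  by rewrite -[X in _ == X](setID _ (moved_ends N)) (setIidPr Ei) setUC.
move=> [E1 E2] /= /and3P[/eqP dis /eqP cover _].
have Ei : E2 \subset ends_at G i by rewrite -cover subsetUr.
rewrite moved_rejoin // -cover setDUl setDv setU0; congr (_, _).
by apply/setDidPl; rewrite -setI_eq0 dis.
Qed.

End Split.

(** * Linear functionals on combinations of graphs *)

Local Open Scope quotient_scope.

Section Pairing.

Variables n s : nat.
Implicit Types (x y : QV n s) (F : mgraph n s -> rat).

(** The value at x of the linear extension of F. *)
Definition pairing x F : rat := \sum_(G <- msupp x) x@_G * F G.

Lemma pairingEw x F (D : {fset mgraph n s}) : (msupp x `<=` D)%fset ->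
  pairing x F = \sum_(G <- D) x@_G * F G.
Proof.
by move=> xD; apply: big_fset_incl => // G _ /mcoeff_outdom->; rewrite mul0r.
Qed.

Lemma pairing0 F : pairing 0 F = 0.
Proof. by rewrite /pairing msupp0 big_seq_fset0. Qed.

Lemma pairingD x y F : pairing (x + y) F = pairing x F + pairing y F.
Proof.
rewrite (pairingEw _ (msuppD_le x y)) (pairingEw _ (fsubsetUl (msupp x) (msupp y))).
rewrite (pairingEw _ (fsubsetUr (msupp x) (msupp y))) -big_split.
by apply: eq_bigr => G _; rewrite mcoeffD mulrDl.
Qed.

Lemma pairingZ a x F : pairing (a *: x) F = a * pairing x F.
Proof.
rewrite (pairingEw _ (msuppZ_le a x)) mulr_sumr.
by apply: eq_bigr => G _; rewrite mcoeffZ mulrA.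
Qed.

Lemma pairing_sum I r (P : pred I) (X : I -> QV n s) F :
  pairing (\sum_(i <- r | P i) X i) F = \sum_(i <- r | P i) pairing (X i) F.
Proof.
apply: (big_morph (fun x => pairing x F)); last exact: pairing0.
by move=> x y; apply: pairingD.
Qed.

Lemma pairingU G F : pairing << G >> F = F G.
Proof. by rewrite /pairing msuppU oner_eq0 big_seq_fset1 mcoeffUU mul1r. Qed.

Lemma pairing_coeff x G : x@_G = pairing x (fun H => (H == G)%:R).
Proof.
have [Gx|Gx] := boolP (G \in msupp x); last first.
  rewrite (mcoeff_outdom Gx) /pairing big_seq big1 // => H Hx.
  by case: eqP Gx => [<-|]; rewrite ?Hx ?mulr0.
rewrite /pairing (big_fsetD1 G) //= eqxx mulr1 big1_seq ?addr0 // => H /=.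
by rewrite !inE => /andP[/negPf-> _]; rewrite mulr0.
Qed.

Lemma eq_pairing x F F' : {in msupp x, F =1 F'} -> pairing x F = pairing x F'.
Proof. by move=> FF'; apply: eq_big_seq => G Gx; rewrite FF'. Qed.

Lemma pairing_sumr x I r (P : pred I) (F : I -> mgraph n s -> rat) :
  pairing x (fun G => \sum_(i <- r | P i) F i G) = \sum_(i <- r | P i) pairing x (F i).
Proof.
by rewrite exchange_big; apply: eq_bigr => G _; rewrite mulr_sumr.
Qed.

Lemma pairing_subr x F F' : pairing x (fun G => F G - F' G) = pairing x F - pairing x F'.
Proof. by rewrite -sumrB; apply: eq_bigr => G _; rewrite mulrBr. Qed.

Lemma pairing_mem x (C : {fset mgraph n s}) :
  pairing x (fun G => (G \in C)%:R) = \sum_(G <- C) x@_G.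
Proof.
rewrite (pairingEw _ (fsubsetUl (msupp x) C)) -(big_fset_incl _ (fsubsetUr (msupp x) C)).
  by apply: eq_big_seq => G ->; rewrite mulr1.
by move=> G _ /negPf->; rewrite mulr0.
Qed.

(** Vanishing of functionals controls the support, since coefficients are functionals. *)
Lemma supported x (Q : pred (mgraph n s)) :
  (forall F, {in Q, F =1 fun=> 0} -> pairing x F = 0) -> {in msupp x, forall G, Q G}.
Proof.
move=> xQ G; rewrite -mcoeff_neq0 pairing_coeff; apply: contraNT => nQG.
rewrite xQ // => H QH; case: eqP => // HG; by rewrite -HG [Q H]QH in nQG.
Qed.

End Pairing.

Lemma pairing_linext n n' s (phi : mgraph n s -> QV n' s) (x : QV n s) F :
  pairing (linext phi x) F = pairing x (fun G => pairing (phi G) F).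
Proof.
by rewrite /linext pairing_sum; apply: eq_bigr => G _; rewrite pairingZ.
Qed.

Lemma pairing_qd1 n s (i : 'I_n) (x : QV n s) F :
  pairing (qd1 i x) F = 2^-1 * pairing x (fun G =>
    \sum_(E : {set ends (repr G)} * {set ends (repr G)} |
        [&& E.1 :&: E.2 == set0, E.1 :|: E.2 == ends_at (repr G) i &
            ~~ connected_graph (split_vertex E.2)])
      F (\pi_(mgraph n.+1 s) (add_edge (repr (\pi_(mgraph n.+1 s) (split_vertex E.2)))
           (old_vertex i) (new_vertex n)))).
Proof.
rewrite /qd1 /l_map /sd_map pairingZ !pairing_linext; congr (_ * _).
apply: eq_pairing => G _; rewrite pairing_sum; apply: eq_bigr => E _.
by rewrite pairingU /l_graph pairingU.
Qed.

Lemma pairing_lb n s (i j : 'I_n) (x : QV n s) F :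
  pairing (lb_map i j x) F = pairing x (fun G =>
    if adj (repr G) i j then 0 else F (\pi_(mgraph n s) (add_edge (repr G) i j))).
Proof.
rewrite /lb_map pairing_linext; apply: eq_pairing => G _; rewrite /lb_graph.
by case: ifP => _; [rewrite pairing0|rewrite /l_graph pairingU].
Qed.

(** * Graphs up to renaming of ends *)

Section Classes.

Variables n s : nat.
Implicit Types G H : mgraph n s.

Definition mskel G : lgraph n s := skel (repr G).

Lemma repr_iso (G : egraph n s) :
  exists f : {ffun ends (repr (\pi_(mgraph n s) G)) -> ends G}, is_iso 1%g f.
Proof.
apply/existsP; have /eqmodP := reprK (\pi_(mgraph n s) G).
by [].
Qed.

Lemma mskel_pi (G : egraph n s) : mskel (\pi_(mgraph n s) G) = skel G.
Proof. by have [f /iso_skel->] := repr_iso G; rewrite relabel1. Qed.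

Lemma nint_pi (G : egraph n s) : nint (repr (\pi_(mgraph n s) G)) = nint G.
Proof. by have [f /iso_nint] := repr_iso G. Qed.

Lemma mskel_inj G H : simple_graph (repr G) -> simple_graph (repr H) ->
  mskel G = mskel H -> G = H.
Proof.
move=> sG sH GH; have idGH : iso_id_equiv n s (repr G) (repr H).
  by apply/existsP; apply: iso_of_skel => //; rewrite relabel1.
by rewrite -[G]reprK -[H]reprK; apply/eqmodP.
Qed.

(** The skeleton forgets the multiplicities of edges, so that a valid skeleton reveals a
    simple graph only together with the number of edges. *)
Lemma VsimpleE k G : (0 < n)%N ->
  Vsimple k G = (nint (repr G) == (n + k).-1) && valid k (mskel G).
Proof.
move=> n_gt0; rewrite /Vsimple /valid conn_skel.
have [cG|_] := boolP (conn (skel (repr G)).1); rewrite /mskel ?andbF //=.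
have -> : cyclomatic (repr G) = (nint (repr G))%:Z - n%:Z + 1.
  pose v0 := Ordinal n_gt0.
  have symG : connect_sym (adj (repr G)).
    by apply: sym_connect_sym => v w; apply/idP/idP; rewrite -!skel_adj; apply: skel_sym.
  congr (_ + Posz _); rewrite -[RHS](n_comp_connect symG v0).
  apply: eq_n_comp_r => v; rewrite !inE.
  by have /connP/(_ v0 v) := cG; rewrite /reach; under eq_connect do rewrite skel_adj.
have -> : ((nint (repr G))%:Z - n%:Z + 1 == k%:Z) = (nint (repr G) == (n + k).-1) by lia.
case: eqP => [nE|_]; rewrite ?andbF //= andbT simple_card.
rewrite -nE andb_idl // => cE; apply: skel_simple.
by rewrite simple_card.
Qed.

End Classes.

(** * The recursion *)

Section Recursion.

Variable s : nat.

Lemma Vsimple_simple n k (G : mgraph n.+1 s) : Vsimple k G ->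
  simple_graph (repr G) && valid k (mskel G).
Proof. by move=> vG; move: (vG); rewrite VsimpleE // => /andP[_ ->]; case/andP: vG => ->. Qed.

Lemma pairing_sigma p k F :
  pairing (sigma s p.+2 k) F = (k + p.+1)%:R^-1 *
    (\sum_(i < p.+1) pairing (qd1 i (sigma s p.+1 k)) F +
     (if (k == 0%N) || (p == 0%N) then 0
      else \sum_(i < p.+2) \sum_(j < p.+2 | (j < i)%N)
             pairing (lb_map i j (sigma s p.+2 k.-1)) F)).
Proof.
rewrite sigmaE pairingZ pairingD pairing_sum addnS subn1 addnS /=; congr (_ * (_ + _)).
rewrite !eqSS; case: ifP => _; first exact: pairing0.
by rewrite pairing_sum; apply: eq_bigr => i _; rewrite pairing_sum.
Qed.

(** The graph that one term of q^d(1) contributes, with the representatives that the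
    composition of the two linear maps picks on the way. *)
Definition rejoined n (G : mgraph n s) (i : 'I_n) (E : {set ends (repr G)}) : mgraph n.+1 s :=
  \pi_(mgraph n.+1 s) (add_edge (repr (\pi_(mgraph n.+1 s) (split_vertex E)))
     (old_vertex i) (new_vertex n)).

Lemma mskel_rejoined n (G : mgraph n s) (i : 'I_n) (E : {set ends (repr G)}) :
  mskel (rejoined i E) = rejoin i E.
Proof. by rewrite mskel_pi skel_add_edge -/(mskel _) mskel_pi. Qed.

Lemma nint_rejoined n (G : mgraph n s) (i : 'I_n) (E : {set ends (repr G)}) :
  nint (repr (rejoined i E)) = (nint (repr G)).+1.
Proof. by rewrite nint_pi /= -/(nint _) nint_pi. Qed.

Lemma Vsimple_rejoined n k (G : mgraph n.+1 s) (i : 'I_n.+1) (E : {set ends (repr G)}) :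
  Vsimple k G -> E \subset ends_at (repr G) i ->
  ~~ connected_graph (split_vertex E) -> Vsimple k (rejoined i E).
Proof.
move=> vG Ei dE; have /andP[sG vsG] := Vsimple_simple vG.
move: vG; rewrite !VsimpleE // nint_rejoined mskel_rejoined => /andP[/eqP-> _].
rewrite !addSn eqxx /=.
by have := bridged_rejoin sG vsG Ei; rewrite dE => /andP[].
Qed.

Lemma Vsimple_add n k (G : mgraph n.+1 s) (v w : 'I_n.+1) :
  Vsimple k G -> v != w -> ~~ adj (repr G) v w ->
  Vsimple k.+1 (\pi_(mgraph n.+1 s) (add_edge (repr G) v w)).
Proof.
move=> vG vw nvw; move: vG; rewrite !VsimpleE // nint_pi mskel_pi skel_add_edge.
case/andP=> /eqP nE vG; rewrite valid_link ?skel_adj // andbT.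
by rewrite /= -/(nint _) nE addnS.
Qed.

Lemma mskel_one_vertex : mskel (one_vertex_graph s) = (set0, [ffun=> ord0]).
Proof.
rewrite mskel_pi; congr (_, _); apply/setP=> z; rewrite inE.
by apply/imsetP=> -[[[]]].
Qed.

(** On a single vertex all internal edges would be loops. *)
Lemma valid_one k (N : lgraph 1 s) : valid k N = (k == 0%N) && (N == (set0, [ffun=> ord0])).
Proof.
have -> : (N == (set0, [ffun=> ord0])) = (N.1 == set0).
  case: N => A x; rewrite xpair_eqE /= andb_idr // => _.
  by apply/eqP/ffunP=> j; rewrite ffunE [x j]ord1.
rewrite /valid add1n /=; apply/and3P/andP=> [[sN _ /eqP kN]|[/eqP-> /eqP->]].
  have := simple_darts_card sN; rewrite kN -cards_eq0 kN.
  by case: (k).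
rewrite cards0; split=> //.
  by apply/simple_dartsP; split=> [v|v w]; rewrite inE.
by apply/connP=> v w; rewrite !ord1; apply: reach_refl.
Qed.

(** Only simple connected graphs occur, so that everything below may be computed on
    skeletons. *)
Lemma sigma_supp n k : {in msupp (sigma s n.+1 k), forall G, Vsimple k G}.
Proof.
elim: n k => [|n IHn] k.
  rewrite sigma1E; case: eqP => [->|_] G; last by rewrite msupp0.
  rewrite msuppU oner_eq0 inE => /eqP->.
  by rewrite VsimpleE // mskel_one_vertex valid_one !eqxx nint_pi.
have qd1_supp k' F : {in @Vsimple n.+2 k' s, F =1 fun=> 0} ->
    \sum_(i < n.+1) pairing (qd1 i (sigma s n.+1 k')) F = 0.
  move=> F0; apply: big1 => i _; rewrite pairing_qd1 (eq_pairing (F' := fun=> 0)).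
    by rewrite /pairing big1 ?mulr0 // => G _; rewrite mulr0.
  move=> G /IHn vG; apply: big1 => -[E1 E2] /= /and3P[_ /eqP cover dE].
  by apply/F0/Vsimple_rejoined => //; rewrite -cover subsetUr.
elim: k => [|k IHk]; apply: supported => F F0; rewrite pairing_sigma qd1_supp // add0r.
  by rewrite mulr0.
case: ifP => _; rewrite ?mulr0 // big1 ?mulr0 // => v _; rewrite big1 // => w wv.
rewrite pairing_lb (eq_pairing (F' := fun=> 0)).
  by rewrite /pairing big1 // => G _; rewrite mulr0.
move=> G /IHk vG; case: ifPn => // nvw; apply/F0/Vsimple_add => //.
by rewrite neq_ltn wv orbT.
Qed.

(** The value at sigma^{n,k,s} of the linear extension of f. *)
Definition evaluate n k (f : lgraph n s -> rat) : rat :=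
  pairing (sigma s n k) (f \o @mskel n s).

Lemma evaluate_one k f :
  evaluate (n := 1) k f = if k == 0%N then f (set0, [ffun=> ord0]) else 0.
Proof.
rewrite /evaluate sigma1E; case: eqP => _; last exact: pairing0.
by rewrite pairingU /= mskel_one_vertex.
Qed.

(** The recursion in adjoint form: the two operations act on the function f. *)
Lemma evaluate_step p k (f : lgraph p.+2 s -> rat) :
  evaluate k f = (k + p.+1)%:R^-1 *
    (2^-1 * evaluate k (contraction_sum k f) +
     (if (k == 0%N) || (p == 0%N) then 0 else evaluate k.-1 (link_sum f))).
Proof.
rewrite /evaluate pairing_sigma; congr (_ * (_ + _)).
  rewrite pairing_sumr mulr_sumr; apply: eq_bigr => i _.
  rewrite pairing_qd1; congr (_ * _); apply: eq_pairing => G vG.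
  have /andP[sG vsG] := Vsimple_simple (sigma_supp vG).
  rewrite -(sum_split _ sG vsG); apply: eq_bigr => E _.
  by rewrite /= -/(rejoined i E.2) mskel_rejoined.
case: ifP => // _; rewrite pairing_sumr; apply: eq_bigr => v _.
rewrite pairing_sumr; apply: eq_bigr => w _.
rewrite pairing_lb; apply: eq_pairing => G _.
by rewrite /= mskel_pi skel_add_edge -skel_adj.
Qed.

Lemma sum_contraction n k (f : lgraph n.+1 s -> rat) : invariant k f ->
  \sum_(M : lgraph n s | valid k M) contraction_sum k f M =
  n.+1%:R^-1 * \sum_(N | valid k N) f N * (\sum_v \sum_w bridge N.1 v w)%N%:R.
Proof.
move=> invf; rewrite -sum_bridged // exchange_big.
by apply: eq_bigr => i _; apply: sum_contract.
Qed.

Lemma sum_all_edges n k (f : lgraph n.+1 s -> rat) :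
  \sum_(N | valid k N) f N * (\sum_v \sum_w bridge N.1 v w)%N%:R +
  \sum_(N | valid k N) f N * (\sum_v \sum_w nonbridge N.1 v w)%N%:R =
  2 * (k + n)%:R * \sum_(N | valid k N) f N.
Proof.
rewrite -big_split mulr_sumr; apply: eq_bigr => N /and3P[_ _ /eqP kN].
rewrite /= -mulrDr -natrD -big_split /=; under eq_bigr do rewrite -big_split.
by rewrite sum_bridges kN addSn /= addnC -mul2n natrM mulrC.
Qed.

(** The first two premises are the induction hypothesis and the evaluation of the second
    sum of the recursion. What remains is that bridges and non-bridges add up to all
    edges. *)
Lemma evaluate_invariant_step n k (f : lgraph n.+2 s -> rat) :
    (forall g : lgraph n.+1 s -> rat, invariant k g ->
      evaluate k g = n.+1`!%:R^-1 * \sum_(M | valid k M) g M) ->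
    (if (k == 0%N) || (n == 0%N) then 0 else evaluate k.-1 (link_sum f)) =
      n.+2`!%:R^-1 *
      (2^-1 * \sum_(N | valid k N) f N * (\sum_v \sum_w nonbridge N.1 v w)%N%:R) ->
  invariant k f -> evaluate k f = n.+2`!%:R^-1 * \sum_(N | valid k N) f N.
Proof.
move=> IHn nonbridges invf; rewrite evaluate_step nonbridges.
rewrite (IHn _ (contraction_sum_invariant invf)) sum_contraction //.
have c_neq0 : (k + n.+1)%:R != 0 :> rat by rewrite pnatr_eq0 addnS.
have -> : \sum_(N | valid k N) f N = (2 * (k + n.+1)%:R)^-1 *
    (\sum_(N | valid k N) f N * (\sum_v \sum_w bridge N.1 v w)%N%:R +
     \sum_(N | valid k N) f N * (\sum_v \sum_w nonbridge N.1 v w)%N%:R).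
  by rewrite sum_all_edges mulKf // mulf_neq0.
rewrite (factS n.+1) natrM !invfM.
set c := (k + n.+1)%:R^-1; set a := n.+2%:R^-1; set b := n.+1`!%:R^-1.
by ring.
Qed.

Lemma evaluate_invariant n k (f : lgraph n.+1 s -> rat) : invariant k f ->
  evaluate k f = n.+1`!%:R^-1 * \sum_(M | valid k M) f M.
Proof.
elim: n k f => [|n IHn] k f.
  move=> _; rewrite evaluate_one invr1 mul1r.
  rewrite (eq_bigl _ _ (@valid_one k)); case: eqP => _ /=; last by rewrite big_pred0_eq.
  by rewrite big_pred1_eq.
have sum_none k' (g : lgraph n.+2 s -> rat) :
    (forall N : lgraph n.+2 s, valid k' N -> forall v w, nonbridge N.1 v w = false) ->
    \sum_(N | valid k' N) g N * (\sum_v \sum_w nonbridge N.1 v w)%N%:R = 0.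
  move=> none; apply: big1 => N vN; rewrite big1 ?mulr0 // => v _.
  by apply: big1 => w _; rewrite none.
elim: k f => [|k IHk] f invf; apply: evaluate_invariant_step => //= [g|]; try exact: IHn.
  by rewrite sum_none ?mulr0 // => N vN v w; apply: nonbridge_tree.
case: eqP => [n0|_]; last by rewrite IHk ?sum_link //; apply: link_sum_invariant.
rewrite sum_none ?mulr0 // => N vN; move: N vN {f invf IHk IHn sum_none}.
by rewrite n0 => N /valid_two.
Qed.

Lemma contraction_sum_ge0 n k (f : lgraph n.+1 s -> rat) M :
  (forall N, 0 <= f N) -> 0 <= contraction_sum k f M.
Proof. by move=> f_ge0; do 2!apply: sumr_ge0 => ? _. Qed.

Lemma link_sum_ge0 n (f : lgraph n s -> rat) M : (forall N, 0 <= f N) -> 0 <= link_sum f M.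
Proof. by move=> f_ge0; do 2!apply: sumr_ge0 => ? _; case: ifP. Qed.

Lemma evaluate_ge0 n k (f : lgraph n s -> rat) : (forall M, 0 <= f M) -> 0 <= evaluate k f.
Proof.
elim: n k f => [|[|n] IHn] k f f_ge0.
- by rewrite /evaluate pairing0.
- by rewrite evaluate_one; case: ifP.
elim: k f f_ge0 => [|k IHk] f f_ge0; rewrite evaluate_step mulr_ge0 ?invr_ge0 //;
  rewrite addr_ge0 ?mulr_ge0 ?invr_ge0 //; try by apply: IHn => M; apply: contraction_sum_ge0.
by case: ifP => // _; apply: IHk => M; apply: link_sum_ge0.
Qed.

Lemma evaluate_le n k (f g : lgraph n s -> rat) : (forall M, f M <= g M) ->
  evaluate k f <= evaluate k g.
Proof.
move=> fg; rewrite -subr_ge0 -pairing_subr.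
by apply: (@evaluate_ge0 _ _ (fun M => g M - f M)) => M; rewrite subr_ge0.
Qed.

(** Evaluates at sigma^{n,k,s} to the coefficient of the simple graph with skeleton N. *)
Definition delta n (N M : lgraph n s) : rat := (M == N)%:R.

Lemma le_delta n (N : lgraph n s) (h : lgraph n s -> rat) :
  (forall M, 0 <= h M) -> 1 <= h N -> forall M, delta N M <= h M.
Proof. by move=> h_ge0 hN M; rewrite /delta; case: eqP => [->|]. Qed.

Lemma last_vertex_edge n k (N : lgraph n.+2 s) : valid k N ->
  exists i : 'I_n.+1, (old_vertex i, new_vertex n.+1) \in N.1.
Proof.
case/and3P=> sN /connP/(_ (new_vertex n.+1) (old_vertex ord0)) cN _.
case/connectP: cN => -[|v r] /= => [_ eq0|/andP[vN _] _].
  by have := old_neq_new (ord0 : 'I_n.+1); rewrite eq0 eqxx.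
case: (vertexP v) vN => [i|] vN; first by exists i; rewrite (simple_darts_sym _ _ sN).
by have [irrN _] := simple_dartsP _ sN; rewrite (negPf (irrN _)) in vN.
Qed.

Lemma delta_ge0 n (N M : lgraph n s) : 0 <= delta N M.
Proof. exact: ler0n. Qed.

Lemma contraction_sum_delta n k (N : lgraph n.+1 s) i :
  bridged k i N -> 1 <= contraction_sum k (delta N) (contract i N).
Proof.
move=> bN; rewrite /contraction_sum (bigD1 i) //= (bigD1 N) ?bN ?eqxx //= {1}/delta eqxx.
rewrite -addrA lerDl addr_ge0 //; first by apply: sumr_ge0 => M _; apply: delta_ge0.
by do 2!apply: sumr_ge0 => ? _; apply: delta_ge0.
Qed.

Lemma link_sum_delta n (N : lgraph n s) (v w : 'I_n) : (w < v)%N ->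
  simple_darts N.1 -> (v, w) \in N.1 -> 1 <= link_sum (delta N) (cut_lgraph N v w).
Proof.
move=> wv sN vwN; rewrite /link_sum (bigD1 v) //= (bigD1 w) //=.
rewrite !inE eqxx /= /link_lgraph /cut_lgraph /= link_cut // -surjective_pairing.
rewrite {1}/delta eqxx -addrA lerDl addr_ge0 //.
  by apply: sumr_ge0 => ? _; case: ifP => // _; apply: delta_ge0.
by do 2!apply: sumr_ge0 => ? _; case: ifP => // _; apply: delta_ge0.
Qed.

(** By evaluate_step the value at N is at least a positive multiple of the value at a
    smaller graph: contract some edge at the last vertex if it is a bridge, and delete it
    otherwise. A non-bridge forces k > 0 and n > 2, so that the deletion term is there. *)
Lemma evaluate_delta_gt0 n k (N : lgraph n.+1 s) : valid k N -> 0 < evaluate k (delta N).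
Proof.
elim: n k N => [|n IHn] k N.
  by rewrite valid_one => /andP[/eqP-> /eqP->]; rewrite evaluate_one /delta /= eqxx.
have contr k' f : (forall M : lgraph n.+2 s, 0 <= f M) ->
    0 <= 2^-1 * evaluate k' (contraction_sum k' f).
  by move=> f_ge0; rewrite mulr_ge0 ?invr_ge0 // evaluate_ge0 // => M; apply: contraction_sum_ge0.
have bridge_gt0 k' (N' : lgraph n.+2 s) i : bridged k' i N' -> 0 < evaluate k' (delta N').
  move=> bN; rewrite evaluate_step mulr_gt0 ?invr_gt0 ?ltr0n ?addnS // ltr_wpDr //.
    case: ifP => // _; apply: evaluate_ge0 => M; apply: link_sum_ge0 => ?.
    exact: delta_ge0.
  rewrite mulr_gt0 ?invr_gt0 //; apply: lt_le_trans (IHn _ _ (valid_contract bN)) _.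
  apply: evaluate_le; apply: le_delta (contraction_sum_delta bN) => M.
  by apply: contraction_sum_ge0 => ?; apply: delta_ge0.
elim: k N => [|k IHk] N vN; have [i iN] := last_vertex_edge vN;
  have [/andP[_ cC]|nC] := boolP (nonbridge N.1 (old_vertex i) (new_vertex n.+1)).
- by have := nonbridge_tree (old_vertex i) (new_vertex n.+1) vN; rewrite /nonbridge iN cC.
- apply: (@bridge_gt0 _ _ i); rewrite /bridged vN /bridge iN /=.
  by move: nC; rewrite /nonbridge iN.
- rewrite evaluate_step /=; case: eqP => [n0|_].
    by move: N vN {i iN cC IHk IHn bridge_gt0 contr}; rewrite n0 => N /valid_two.
  have [sN _ _] := and3P vN; rewrite (simple_darts_sym _ _ sN) in iN.
  have vC : valid k (cut_lgraph N (new_vertex n.+1) (old_vertex i)).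
    by apply: valid_cut => //; rewrite /nonbridge iN cutC.
  rewrite mulr_gt0 ?invr_gt0 ?ltr0n // ltr_wpDl //; first by apply: contr => M; apply: delta_ge0.
  apply: lt_le_trans (IHk _ vC) _; apply: evaluate_le; apply: le_delta.
    by move=> M; apply: link_sum_ge0 => ?; apply: delta_ge0.
  by apply: link_sum_delta => //=.
- apply: (@bridge_gt0 _ _ i); rewrite /bridged vN /bridge iN /=.
  by move: nC; rewrite /nonbridge iN.
Qed.

Lemma sigma_coeff_gt0 n k (G : mgraph n.+1 s) : Vsimple k G -> 0 < (sigma s n.+1 k)@_G.
Proof.
move=> /Vsimple_simple/andP[sG vG]; rewrite pairing_coeff.
rewrite (eq_pairing (F' := delta (mskel G) \o @mskel _ s)); first exact: evaluate_delta_gt0.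
move=> H /sigma_supp/Vsimple_simple/andP[sH _] /=; rewrite /delta.
suff -> : (H == G) = (mskel H == mskel G) by [].
by apply/eqP/eqP => [->|/mskel_inj->].
Qed.

(** The indicator of the class depends only on the skeleton and is invariant, being the
    indicator of an orbit. *)
Lemma sigma_class_sum n k (C : {fset mgraph n.+1 s}) (G : mgraph n.+1 s) :
  is_iso_class C -> (forall H, H \in C -> Vsimple k H) -> G \in C ->
  \sum_(H <- C) (sigma s n.+1 k)@_H = (symmetry_factor G)%:R^-1.
Proof.
case=> G0 CE CV CG; rewrite -pairing_mem.
pose O := orbit (relabel_action n.+1 s) setT (mskel G).
have /andP[sG vG] := Vsimple_simple (CV G CG).
have sG0 : simple_graph (repr G0).
  have: iso (repr G0) (repr G) by rewrite -[iso _ _]/(isomorphic _ _) -CE.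
  by case/existsP=> p /existsP[f /iso_simple <-].
have OG : O = orbit (relabel_action n.+1 s) setT (mskel G0).
  by apply/orbit_eqP; rewrite -iso_orbit // -[iso _ _]/(isomorphic _ _) -CE.
rewrite (eq_pairing (F' := (fun M => (M \in O)%:R) \o @mskel _ s)); last first.
  move=> H /sigma_supp/Vsimple_simple/andP[sH _] /=.
  by rewrite CE /isomorphic iso_orbit // OG.
rewrite -[LHS]/(evaluate k (fun M => (M \in O)%:R)) evaluate_invariant; last first.
  by move=> M p _; rewrite -[relabel M p]/(relabel_action n.+1 s M p) orbit_actr ?inE.
rewrite /symmetry_factor -(card_orbit_symfactor sG) -/(mskel G) -/O.
have -> : \sum_(M | valid k M) (M \in O)%:R = #|O|%:R :> rat.
  rewrite -sum1_card natr_sum [LHS]big_mkcond [RHS]big_mkcond /=; apply: eq_bigr => M _.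
  have [/orbitP[p _ <-]|_] := boolP (M \in O); last by case: ifP.
  by rewrite /= valid_relabel vG.
have O_neq0 : #|O|%:R != 0 :> rat.
  by rewrite pnatr_eq0 -lt0n; apply/card_gt0P; exists (mskel G); apply: orbit_refl.
by rewrite natrM invfM mulrAC mulVf // mul1r.
Qed.

End Recursion.

Unset Implicit Arguments.

Theorem theorem12 (s n k : nat) (n_gt0 : (0 < n)%N) :
  exists (W : {fset mgraph n s}) (alpha : mgraph n s -> rat),
    [/\ forall G : mgraph n s, (G \in W) = Vsimple k G,
        sigma s n k = \sum_(G <- W) alpha G *: (<< G >> : QV n s),
        forall G : mgraph n s, Vsimple k G -> 0 < alpha G &
        forall C : {fset mgraph n s},
          is_iso_class C -> (forall G, G \in C -> Vsimple k G) ->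
          forall G, G \in C ->
            \sum_(H <- C) alpha H = (symmetry_factor G)%:R^-1].
Proof.
case: n n_gt0 => // n _; exists (msupp (sigma s n.+1 k)), (fun G => (sigma s n.+1 k)@_G).
split=> [G||G|C classC CV G CG].
- apply/idP/idP=> [/sigma_supp //|/sigma_coeff_gt0].
  by rewrite -mcoeff_neq0 => /lt0r_neq0.
- rewrite {1}[sigma s n.+1 k]monalgE; apply: eq_bigr => G _; apply/malgP=> H.
  by rewrite mcoeffZ !mcoeffU mulr_natr.
- exact: sigma_coeff_gt0.
- exact: sigma_class_sum classC CV CG.
Qed.
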